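(* There is a Turing degree $\mathbf d$ with $\mathbf d'\equiv_T\mathcal O$ that is uniformly high for descending sequences but not high for isomorphism, and such that there is no degree $\mathbf b$ with $\mathbf d\le_T\mathbf b$ and $\mathcal O\not\le_T\mathbf b$ that is uniformly high for descending sequences in the reticent sense.
   Context: Kleene's $\mathcal O$ may be taken as $\{e:\{e\}^\emptyset$ is the graph of a binary relation that well-orders $\omega\}$. Let $(\mathcal L_e)_{e\in\omega}$ be an effective listing of the computable linear orders. A degree $\mathbf d$ is uniformly high for descending sequences if there are $D\in\mathbf d$ and a total computable $f$ such that for every $e$ with $\mathcal L_e$ ill-founded, $\{f(e)\}^D$ is an infinite descending sequence in $\mathcal L_e$; it is so in the reticent sense if moreover $f$ can be chosen so that for every $e$ with $\mathcal L_e$ well-founded, $\{f(e)\}^D$ diverges on every input. A degree $\mathbf d$ is high for isomorphism if for any two isomorphic computable structures there is a $\mathbf d$-computable isomorphism between them. *)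

(* Defs.v *)
From Stdlib Require Cantor.
From mathcomp Require Import all_boot.
From mathcomp Require Import boolp classical_sets functions.
From mathcomp Require wochoice.

Set Implicit Arguments.
Unset Strict Implicit.
Unset Printing Implicit Defensive.

Local Open Scope classical_set_scope.

Definition npair (x y : nat) : nat := Cantor.to_nat (x, y).
Definition nfst (n : nat) : nat := (Cantor.of_nat n).1.
Definition nsnd (n : nat) : nat := (Cantor.of_nat n).2.

Lemma nfstK x y : nfst (npair x y) = x.
Proof. by rewrite /nfst /npair Cantor.cancel_of_to. Qed.

Lemma nsndK x y : nsnd (npair x y) = y.
Proof. by rewrite /nsnd /npair Cantor.cancel_of_to. Qed.

Lemma npairK n : npair (nfst n) (nsnd n) = n.
Proof. by rewrite /npair /nfst /nsnd -surjective_pairing Cantor.cancel_to_of. Qed.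

(* The partial recursive functions relative to an oracle, as unary functions  *)
(* on natural numbers; several arguments are passed through [npair].          *)
Inductive code :=
| CZero | CSucc | CFst | CSnd | COracle
| CPair of code & code
| CComp of code & code
| CPrec of code & code
| CMu of code.

(* [eval k A c n = Some m]: with recursion depth at most [k], the program [c] *)
(* on input [n] with oracle [A] halts with output [m].  The recursion in      *)
(* [CPrec] is on the second component of the input; [CMu c] on [npair x m]    *)
(* returns the least [i >= m] at which [c (npair x i)] is 0, all earlier      *)
(* values being defined.                                                      *)
Fixpoint eval (k : nat) (A : set nat) (c : code) (n : nat) : option nat :=
  if k is k'.+1 then
    match c with
    | CZero => Some 0
    | CSucc => Some n.+1
    | CFst => Some (nfst n)
    | CSnd => Some (nsnd n)
    | COracle => Some (nat_of_bool (n \in A))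
    | CPair a b =>
        if eval k' A a n is Some x then
          if eval k' A b n is Some y then Some (npair x y) else None
        else None
    | CComp a b => if eval k' A b n is Some x then eval k' A a x else None
    | CPrec a b =>
        if nsnd n is m.+1 then
          if eval k' A c (npair (nfst n) m) is Some r then
            eval k' A b (npair (nfst n) (npair m r))
          else None
        else eval k' A a (nfst n)
    | CMu a =>
        match eval k' A a n with
        | Some 0 => Some (nsnd n)
        | Some _.+1 => eval k' A c (npair (nfst n) (nsnd n).+1)
        | None => None
        end
    end
  else None.

Lemma eval_leq k l A c n m : k <= l -> eval k A c n = Some m ->
  eval l A c n = Some m.
Proof.
elim: k l c n m => [//|k IH] [//|l] c n m; rewrite ltnS => /IH{}IH.
case: c => //= [a b|a b|a b|a].
- case Ea: (eval k A a n) => [x|//]; case Eb: (eval k A b n) => [y|//].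
  by rewrite (IH _ _ _ Ea) (IH _ _ _ Eb).
- case Eb: (eval k A b n) => [x|//]; rewrite (IH _ _ _ Eb); exact: IH.
- case: (nsnd n) => [|i]; first exact: IH.
  case Ec: (eval k _ _ _) => [x|//]; rewrite (IH _ _ _ Ec); exact: IH.
- case Ea: (eval k A a n) => [[|x]|//]; rewrite (IH _ _ _ Ea) //; exact: IH.
Qed.

Fixpoint encode (c : code) : nat :=
  match c with
  | CZero => 0
  | CSucc => 1
  | CFst => 2
  | CSnd => 3
  | COracle => 4
  | CPair a b => 5 + (npair (encode a) (encode b) * 4 + 0)
  | CComp a b => 5 + (npair (encode a) (encode b) * 4 + 1)
  | CPrec a b => 5 + (npair (encode a) (encode b) * 4 + 2)
  | CMu a => 5 + (encode a * 4 + 3)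
  end.

(* The first argument is fuel; [n.+1] suffices, see [encodeK] and [decodeK].  *)
Fixpoint decode_fuel (f n : nat) : code :=
  if f is f'.+1 then
    match n with
    | 0 => CZero
    | 1 => CSucc
    | 2 => CFst
    | 3 => CSnd
    | 4 => COracle
    | n'.+4.+1 =>
        let q := n' %/ 4 in
        let a := decode_fuel f' (nfst q) in
        let b := decode_fuel f' (nsnd q) in
        match n' %% 4 with
        | 0 => CPair a b
        | 1 => CComp a b
        | 2 => CPrec a b
        | _ => CMu (decode_fuel f' q)
        end
    end
  else CZero.

Definition decode (n : nat) : code := decode_fuel n.+1 n.

Lemma nfst_leq n : nfst n <= n.
Proof.
rewrite -[leqRHS]npairK; apply/leP; apply: PeanoNat.Nat.le_trans;
  last exact: Cantor.to_nat_non_decreasing.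
exact: PeanoNat.Nat.le_add_l.
Qed.

Lemma nsnd_leq n : nsnd n <= n.
Proof.
rewrite -[leqRHS]npairK; apply/leP; apply: PeanoNat.Nat.le_trans;
  last exact: Cantor.to_nat_non_decreasing.
exact: PeanoNat.Nat.le_add_r.
Qed.

Lemma decode_fuelK f n : n < f -> encode (decode_fuel f n) = n.
Proof.
elim: f n => [//|f IH] [|[|[|[|[|n]]]]] // ltnf.
have ltq : n %/ 4 < f.
  apply: leq_ltn_trans (leq_div n 4) _; apply: leq_trans (ltnf : n.+4 < f).
  by rewrite ltnS -addn4 leq_addr.
have lt1 := leq_ltn_trans (nfst_leq (n %/ 4)) ltq.
have lt2 := leq_ltn_trans (nsnd_leq (n %/ 4)) ltq.
rewrite [decode_fuel _ _]/=.
move: (divn_eq n 4) (ltn_pmod n (isT : 0 < 4)).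
case: (n %% 4) => [|[|[|[|//]]]] En _ /=; rewrite !IH // ?npairK;
  by rewrite -En.
Qed.

Lemma decodeK : cancel decode encode.
Proof. by move=> n; apply: decode_fuelK. Qed.

Lemma encode_inj : injective encode.
Proof.
have dec4 q q' r r' : r < 4 -> r' < 4 -> 5 + (q * 4 + r) = 5 + (q' * 4 + r') ->
    q = q' /\ r = r'.
  move=> lr lr' /addnI E; have /(congr1 (divn^~ 4)) := E.
  rewrite !divnMDl // !divn_small // !addn0 => Eq; split=> //.
  by move: E; rewrite Eq => /addnI.
have pinj x y x' y' : npair x y = npair x' y' -> x = x' /\ y = y'.
  by move=> E; split; [rewrite -(nfstK x y) E nfstK | rewrite -(nsndK x y) E nsndK].
elim=> [|||||a IHa b IHb|a IHa b IHb|a IHa b IHb|a IHa];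
  case=> [|||||a' b'|a' b'|a' b'|a'] //= /dec4-[] // /[swap] // _.
- by move=> /pinj[/IHa-> /IHb->].
- by move=> /pinj[/IHa-> /IHb->].
- by move=> /pinj[/IHa-> /IHb->].
- by move=> /IHa->.
Qed.

Lemma encodeK : cancel encode decode.
Proof. by move=> c; apply: encode_inj; rewrite decodeK. Qed.

(* [phi e A n m] is {e}^A(n) = m.                                             *)
Definition phi (e : nat) (A : set nat) (n m : nat) : Prop :=
  exists k, eval k A (decode e) n = Some m.

Definition computes (e : nat) (A : set nat) (f : nat -> nat) : Prop :=
  forall n, phi e A n (f n).

Definition computable_fun (f : nat -> nat) : Prop := exists e, computes e set0 f.

Definition char_fun (A : set nat) : nat -> nat := fun n => nat_of_bool (n \in A).

Definition turing_le (A B : set nat) : Prop := exists e, computes e B (char_fun A).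

Definition turing_equiv (A B : set nat) : Prop := turing_le A B /\ turing_le B A.

Definition computable_set (A : set nat) : Prop := turing_le A set0.

Definition jump (A : set nat) : set nat := [set e | exists m, phi e A e m].

Definition kleeneO : set nat :=
  [set e | exists R : rel nat,
     (forall x y, phi e set0 (npair x y) (nat_of_bool (R x y))) /\
     wochoice.well_order R].

Record degree := Degree {
  degree_class :> set nat -> Prop;
  degree_classP : exists A, degree_class = [set B | turing_equiv B A] }.

Definition degree_of (A : set nat) : degree :=
  Degree (ex_intro _ A (erefl [set B | turing_equiv B A])).

Definition degree_le (a b : degree) : Prop :=
  forall A B, a A -> b B -> turing_le A B.

(* [is_jump d c]: the degree [c] is d'.                                       *)
Definition is_jump (d c : degree) : Prop := forall D, d D -> c (jump D).

(* The listing of computable linear orders.  Regarding {e}^0 as a (partial)   *)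
(* binary relation on the natural numbers, [lo_approved e k x] says that      *)
(* within [k] steps it is seen to be defined on {0,...,x} and to be a         *)
(* (reflexive) linear order there.  An element of L_e is a pair (x, k) where  *)
(* [k] is the least such number of steps for [x], and such pairs are ordered  *)
(* by their first components according to {e}^0.  The [lo_dom e] and          *)
(* [lo_le e] are thus uniformly computable, every L_e is a linear order       *)
(* ([lo_linear]), and if {e}^0 is a linear order of the natural numbers then  *)
(* L_e is a copy of it ([lo_complete]).  Otherwise L_e is finite.             *)
Definition lo_test (e k x y b : nat) : bool :=
  eval k set0 (decode e) (npair x y) == Some b.

Definition lo_approved (e k x : nat) : bool :=
  [&& [forall u : 'I_x.+1, forall v : 'I_x.+1,
         lo_test e k u v 0 || lo_test e k u v 1],
      [forall u : 'I_x.+1, forall v : 'I_x.+1,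
         lo_test e k u v 1 || lo_test e k v u 1],
      [forall u : 'I_x.+1, forall v : 'I_x.+1,
         lo_test e k u v 1 && lo_test e k v u 1 ==> (u == v)] &
      [forall u : 'I_x.+1, forall v : 'I_x.+1, forall w : 'I_x.+1,
         lo_test e k u v 1 && lo_test e k v w 1 ==> lo_test e k u w 1]].

Definition lo_dom (e : nat) : pred nat := fun z =>
  lo_approved e (nsnd z) (nfst z) &&
  [forall j : 'I_(nsnd z), ~~ lo_approved e j (nfst z)].

Definition lo_le (e : nat) : rel nat := fun z w =>
  lo_test e (maxn (nsnd z) (nsnd w)) (nfst z) (nfst w) 1.

Definition lo_lt (e : nat) : rel nat := fun z w => lo_le e z w && (z != w).

(* Every nonempty subset of L_e has a unique least element.                   *)
Definition lo_wf (e : nat) : Prop := wochoice.wo_chain (lo_le e) (lo_dom e).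

Definition descending_in (e : nat) (s : nat -> nat) : Prop :=
  forall n, s n \in lo_dom e /\ lo_lt e (s n.+1) (s n).

Definition finds_descending (D : set nat) (f : nat -> nat) : Prop :=
  forall e, ~ lo_wf e ->
    exists s : nat -> nat, computes (f e) D s /\ descending_in e s.

Definition unif_high_desc (d : degree) : Prop :=
  exists (D : set nat) (f : nat -> nat),
    [/\ d D, computable_fun f & finds_descending D f].

Definition unif_high_desc_reticent (d : degree) : Prop :=
  exists (D : set nat) (f : nat -> nat),
    [/\ d D, computable_fun f, finds_descending D f &
        forall e, lo_wf e -> forall n m, ~ phi (f e) D n m].

Fixpoint tuple_code (xs : seq nat) : nat :=
  if xs is x :: xs' then (npair x (tuple_code xs')).+1 else 0.

(* A countable language: the symbols are indexed by sets of natural numbers   *)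
(* (arities off these sets are irrelevant); constants are 0-ary functions.    *)
Record language := Language {
  rel_sym : set nat;
  rel_ar : nat -> nat;
  fun_sym : set nat;
  fun_ar : nat -> nat }.

Definition computable_language (L : language) : Prop :=
  [/\ computable_set (rel_sym L), computable_fun (rel_ar L),
      computable_set (fun_sym L) & computable_fun (fun_ar L)].

Definition tuple_in (X : set nat) (k : nat) (xs : seq nat) : Prop :=
  size xs = k /\ forall x, x \in xs -> X x.

Record structure (L : language) := Structure {
  dom : set nat;
  rel_int : nat -> seq nat -> Prop;
  fun_int : nat -> seq nat -> nat;
  fun_int_dom : forall i xs, fun_sym L i -> tuple_in dom (fun_ar L i) xs ->
    dom (fun_int i xs) }.

Definition computable_structure (L : language) (M : structure L) : Prop :=
  [/\ computable_set (dom M),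
      exists e, forall i xs, rel_sym L i -> tuple_in (dom M) (rel_ar L i) xs ->
        phi e set0 (npair i (tuple_code xs)) (nat_of_bool `[< rel_int M i xs >]) &
      exists e, forall i xs, fun_sym L i -> tuple_in (dom M) (fun_ar L i) xs ->
        phi e set0 (npair i (tuple_code xs)) (fun_int M i xs)].

Definition isomorphism (L : language) (M N : structure L) (g : nat -> nat) :
    Prop :=
  [/\ set_bij (dom M) (dom N) g,
      forall i xs, rel_sym L i -> tuple_in (dom M) (rel_ar L i) xs ->
        (rel_int M i xs <-> rel_int N i (map g xs)) &
      forall i xs, fun_sym L i -> tuple_in (dom M) (fun_ar L i) xs ->
        g (fun_int M i xs) = fun_int N i (map g xs)].

Definition isomorphic (L : language) (M N : structure L) : Prop :=
  exists g, isomorphism M N g.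

Definition high_for_iso (d : degree) : Prop :=
  forall (L : language) (M N : structure L), computable_language L ->
    computable_structure M -> computable_structure N -> isomorphic M N ->
    exists g : nat -> nat, isomorphism M N g /\
      exists (D : set nat) (e : nat), d D /\ forall x, dom M x -> phi e D x (g x).

Lemma lo_test_leq e k l x y b : k <= l -> lo_test e k x y b -> lo_test e l x y b.
Proof. by move=> kl /eqP H; apply/eqP; apply: eval_leq H. Qed.

Lemma lo_test_fun e k l x y b c : lo_test e k x y b -> lo_test e l x y c -> b = c.
Proof.
move=> /(lo_test_leq (leq_maxl k l))/eqP H1.
by move=> /(lo_test_leq (leq_maxr k l))/eqP; rewrite H1 => -[].
Qed.

Lemma lo_approvedP e k x : reflect
  [/\ forall u v, u <= x -> v <= x -> lo_test e k u v 0 || lo_test e k u v 1,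
      forall u v, u <= x -> v <= x -> lo_test e k u v 1 || lo_test e k v u 1,
      forall u v, u <= x -> v <= x ->
        lo_test e k u v 1 -> lo_test e k v u 1 -> u = v &
      forall u v w, u <= x -> v <= x -> w <= x ->
        lo_test e k u v 1 -> lo_test e k v w 1 -> lo_test e k u w 1]
  (lo_approved e k x).
Proof.
apply: (iffP and4P) => -[H1 H2 H3 H4]; split.
- by move=> u v ux vx; have /forallP/(_ (Ordinal (ux : u < x.+1)))/forallP/(_
    (Ordinal (vx : v < x.+1))) := H1.
- by move=> u v ux vx; have /forallP/(_ (Ordinal (ux : u < x.+1)))/forallP/(_
    (Ordinal (vx : v < x.+1))) := H2.
- move=> u v ux vx uv vu; have /forallP/(_ (Ordinal (ux : u < x.+1)))/forallP/(_
    (Ordinal (vx : v < x.+1))) := H3.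
  by rewrite /= uv vu => /eqP[].
- move=> u v w ux vx wx uv vw.
  have /forallP/(_ (Ordinal (ux : u < x.+1)))/forallP/(_
    (Ordinal (vx : v < x.+1)))/forallP/(_ (Ordinal (wx : w < x.+1))) := H4.
  by rewrite /= uv vw.
- by apply/forallP=> u; apply/forallP=> v; apply: H1; rewrite -ltnS.
- by apply/forallP=> u; apply/forallP=> v; apply: H2; rewrite -ltnS.
- apply/forallP=> u; apply/forallP=> v; apply/implyP=> /andP[uv vu].
  by apply/eqP/val_inj; apply: H3 uv vu; rewrite -ltnS.
- apply/forallP=> u; apply/forallP=> v; apply/forallP=> w.
  by apply/implyP=> /andP[]; apply: H4; rewrite -ltnS.
Qed.

Lemma lo_dom_inj e z w : lo_dom e z -> lo_dom e w -> nfst z = nfst w -> z = w.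
Proof.
move=> /andP[az /forallP mz] /andP[aw /forallP mw] E.
suff Es : nsnd z = nsnd w by rewrite -(npairK z) -(npairK w) E Es.
apply/eqP; case: ltngtP => // lt.
- by have := mw (Ordinal lt); rewrite /= -E az.
- by have := mz (Ordinal lt); rewrite /= E aw.
Qed.

(* On L_e, the bounded test in [lo_le] agrees with the unbounded one.         *)
Lemma lo_leP e z w : lo_dom e z -> lo_dom e w ->
  reflect (phi e set0 (npair (nfst z) (nfst w)) 1) (lo_le e z w).
Proof.
move=> /andP[/lo_approvedP[az _ _ _] _] /andP[/lo_approvedP[aw _ _ _] _].
apply: (iffP idP) => [/eqP H|[k /eqP kP]]; first by eexists; exact: H.
have [le|/ltnW le] := leqP (nfst z) (nfst w).
- have /orP[t|t] := aw _ _ le (leqnn _).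
    by have := lo_test_fun t kP.
  exact: lo_test_leq (leq_maxr _ _) t.
- have /orP[t|t] := az _ _ (leqnn _) le.
    by have := lo_test_fun t kP.
  exact: lo_test_leq (leq_maxl _ _) t.
Qed.

Lemma lo_linear e : {in lo_dom e &, total (lo_le e)} /\
  {in lo_dom e &, antisymmetric (lo_le e)} /\
  {in lo_dom e & &, transitive (lo_le e)}.
Proof.
pose K z := lo_approved e (nsnd z) (nfst z).
have domK z : z \in lo_dom e -> K z by move=> /andP[].
have up z w x : z \in lo_dom e -> w \in lo_dom e -> nfst z <= x -> nfst w <= x ->
    forall k, lo_approved e k x -> lo_le e z w -> lo_test e k (nfst z) (nfst w) 1.
  move=> Dz Dw zx wx k /lo_approvedP[ak _ _ _] t.
  by have /orP[s|//] := ak _ _ zx wx; have := lo_test_fun t s.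
split; [|split].
- move=> z w Dz Dw; have [zw|/ltnW wz] := leqP (nfst z) (nfst w).
    have /lo_approvedP[_ H _ _] := domK _ Dw.
    have /orP[t|t] := H _ _ zw (leqnn _); apply/orP; [left|right];
      apply/(lo_leP _ _) => //; by exists (nsnd w); apply/eqP.
  have /lo_approvedP[_ H _ _] := domK _ Dz.
  have /orP[t|t] := H _ _ (leqnn _) wz; apply/orP; [left|right];
    apply/(lo_leP _ _) => //; by exists (nsnd z); apply/eqP.
- move=> z w Dz Dw /andP[zw wz]; apply: (lo_dom_inj Dz Dw).
  have [lzw|/ltnW lwz] := leqP (nfst z) (nfst w).
    have /lo_approvedP[_ _ H _] := domK _ Dw.
    by apply: H => //; apply: (up _ _ (nfst w)) => //; apply: domK.
  have /lo_approvedP[_ _ H _] := domK _ Dz.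
  by apply: H => //; apply: (up _ _ (nfst z)) => //; apply: domK.
- move=> w z v Dw Dz Dv zw wv; apply/(lo_leP Dz Dv).
  pose x := maxn (nfst z) (maxn (nfst w) (nfst v)).
  have [k ak] : exists k, lo_approved e k x.
    rewrite /x /maxn; case: ifP => _; last by exists (nsnd z); apply: domK.
    by case: ifP => _; [exists (nsnd v)|exists (nsnd w)]; apply: domK.
  have [zx [wx vx]] : nfst z <= x /\ nfst w <= x /\ nfst v <= x.
    by rewrite /x !leq_max !leqnn !orbT.
  have /lo_approvedP[_ _ _ H] := ak; exists k; apply/eqP.
  by apply: (H _ (nfst w)) => //; apply: (up _ _ x).
Qed.

Lemma lo_complete e (R : rel nat) :
  (forall x y, phi e set0 (npair x y) (nat_of_bool (R x y))) ->
  total R -> antisymmetric R -> transitive R ->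
  exists g : nat -> nat, set_bij setT [set` lo_dom e] g /\
    forall x y, R x y = lo_le e (g x) (g y).
Proof.
move=> eR Rt Ra Rtr.
have testR k x y b : lo_test e k x y b -> R x y = b :> nat.
  have [l /eqP El] := eR x y => t; exact: lo_test_fun El t.
have ex x : exists k, lo_approved e k x.
  have [k kP] : exists k, forall u v, u <= x -> v <= x -> lo_test e k u v (R u v).
    have [K KP] : exists K : nat -> nat -> nat, forall u v,
        lo_test e (K u v) u v (R u v).
      have : forall p : nat * nat, exists k, lo_test e k p.1 p.2 (R p.1 p.2).
        by move=> [u v]; have [k /eqP] := eR u v; exists k.
      by move=> /choice[K KP]; exists (fun u v => K (u, v)) => u v; apply: (KP (u, v)).
    exists (\max_(u < x.+1) \max_(v < x.+1) K u v) => u v ux vx.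
    apply: lo_test_leq (KP u v).
    apply: leq_trans (leq_bigmax (Ordinal (ux : u < x.+1))) => /=.
    exact: (leq_bigmax (Ordinal (vx : v < x.+1))).
  have tR u v : u <= x -> v <= x -> lo_test e k u v 1 = R u v.
    move=> ux vx; have := kP u v ux vx; case E: (R u v) => // t.
    by apply/negP => s; have := lo_test_fun t s.
  exists k; apply/lo_approvedP; split.
  - by move=> u v ux vx; have := kP u v ux vx; case: (R u v) => ->; rewrite ?orbT.
  - by move=> u v ux vx; rewrite !tR //; apply: Rt.
  - by move=> u v ux vx; rewrite !tR // => uv vu; apply: Ra; rewrite uv.
  - by move=> u v w ux vx wx; rewrite !tR //; apply: Rtr.
pose g x := npair x (ex_minn (ex x)).
have gdom x : lo_dom e (g x).
  rewrite /lo_dom /g nfstK nsndK; case: ex_minnP => k -> min /=.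
  apply/forallP=> j; apply/negP=> /min; rewrite leqNgt => /negP; apply.
  exact: ltn_ord.
exists g; split.
  split; first by move=> x _; apply: gdom.
    by move=> x y _ _ /(congr1 nfst); rewrite /g !nfstK.
  move=> z Dz; exists (nfst z) => //; apply: (lo_dom_inj (gdom _) Dz).
  by rewrite /g nfstK.
move=> x y; apply/idP/(lo_leP (gdom x) (gdom y)); rewrite /g !nfstK.
  by move=> Rxy; have := eR x y; rewrite Rxy.
by case=> k /eqP/testR; case: (R x y).
Qed.

(* Main.v *)
(* If g majorizes, for every ill-founded computable linear order, one of its  *)
(* descending sequences, then descending sequences are found uniformly from g *)
(* by taking largest elements among those below g.  By Koenig's lemma O is    *)
(* then c.e. in g.  So O is computable in g', and also in every B above g     *)
(* that enumerates the ill-founded orders, as a reticent B does.              *)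
(*                                                                            *)
(* It remains to find a fast growing g such that g' is computable in O and    *)
(* which is not high for isomorphism.  The forcing conditions are pairs of a  *)
(* string and a Pi^0_1 class of lower bounds for g, closed under increasing   *)
(* values.  O decides whether such a class is empty, hence decides g'.        *)
(*                                                                            *)
(* To diagonalize against a program c at a condition, take for argument n the *)
(* condition itself, together with c, and let T_j be the tree of the bounds   *)
(* that prevent c from taking the value j at n.  Either there is a map from   *)
(* T_1 to T_0 that preserves levels, or there is one from T_0 to T_1 that     *)
(* raises them by one; the first is a witness for 0, the second one for 1.    *)
(* If both exist, both trees have paths, and c can be kept from taking the    *)
(* values 0 and 1.  If j has no witness, T_j has no path and the value j can  *)
(* be forced.  So no function computable in g has a witness at all places.    *)
(* Functions with witnesses are the paths of a computable tree, and a pair of *)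
(* computable structures is built from torsors of finite sets of nodes, so    *)
(* that every isomorphism between them computes a path.                       *)

From Stdlib Require Cantor.
From mathcomp Require Import all_boot.
From mathcomp Require Import zify.
From mathcomp Require Import boolp classical_sets functions.
From mathcomp Require wochoice.
Require Import Defs.

Set Implicit Arguments.
Unset Strict Implicit.
Unset Printing Implicit Defensive.

(** * Closure properties of relative computability *)

(** Membership in O and the absence of a path through a computable tree reduce to each other
    ([kb_index], [kleeneO_nonO]). Hence O computes a function [h] that lists the leftmost descending
    sequence of every ill-founded L_e ([leftmost_path]). The required degree is that of the graph of
    some [g] above [h]. Such a bound turns the search for descending sequences into a finitely
    branching one, which gives [bounding_finds] and, by compactness, an enumeration of O from [g]
    ([kleeneO_sigma1]). Both [kleeneO_le_jump] and [reticent_above] follow from that enumeration.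

    The function [g] comes from a forcing that O can carry out ([generic_function]). A condition
    restrains [g] only by keeping it above some member of a Pi^0_1 class. So values past the current
    string may be raised freely, two restraints on the same string combine by pointwise maximum, and
    consistency is a question to O.

    To defeat isomorphisms it suffices that some computable tree has a path but none computable in
    [g] ([isomorphism_path]). *)

Definition evals (A : set nat) (c : code) (n m : nat) : Prop :=
  exists k, eval k A c n = Some m.

Lemma evals_fun A c n m m' : evals A c n m -> evals A c n m' -> m = m'.
Proof.
move=> [k /(eval_leq (leq_maxl k _)) Ek] [l /(eval_leq (leq_maxr k _)) El].
by move: (Ek l); rewrite El => -[].
Qed.

Definition computable_in (A : set nat) (f : nat -> nat) : Prop :=
  exists c, forall n, evals A c n (f n).

Definition decidable_in (A : set nat) (p : nat -> bool) : Prop :=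
  computable_in A (fun n => nat_of_bool (p n)).

Lemma computable_inP A f : computable_in A f <-> exists e, computes e A f.
Proof.
split=> [[c cP]|[e eP]]; last by exists (decode e).
by exists (encode c) => n; rewrite /phi encodeK; apply: cP.
Qed.

Fixpoint nrec (b : nat) (s : nat -> nat -> nat) (n : nat) : nat :=
  if n is m.+1 then s m (nrec b s m) else b.

Section Closure.
Variable A : set nat.
Local Notation ci := (computable_in A).
Local Notation di := (decidable_in A).

Lemma ci_ext f g : ci f -> f =1 g -> ci g.
Proof. by move=> [c cP] E; exists c => n; rewrite -E. Qed.

Lemma evals_pair a b n x y : evals A a n x -> evals A b n y ->
  evals A (CPair a b) n (npair x y).
Proof.
move=> [k Ek] [l El]; exists (maxn k l).+1 => /=.
by rewrite (eval_leq (leq_maxl k l) Ek) (eval_leq (leq_maxr k l) El).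
Qed.

Lemma evals_comp a b n x y : evals A b n x -> evals A a x y ->
  evals A (CComp a b) n y.
Proof.
move=> [k Ek] [l El]; exists (maxn k l).+1 => /=.
by rewrite (eval_leq (leq_maxl k l) Ek) (eval_leq (leq_maxr k l) El).
Qed.

Lemma ci_pair f g : ci f -> ci g -> ci (fun x => npair (f x) (g x)).
Proof. by move=> [a aP] [b bP]; exists (CPair a b) => n; apply: evals_pair. Qed.

Lemma ci_comp f g : ci f -> ci g -> ci (fun x => f (g x)).
Proof. by move=> [a aP] [b bP]; exists (CComp a b) => n; apply: evals_comp. Qed.

Lemma ci_id : ci (fun x => x).
Proof.
exists (CPair CFst CSnd) => n; rewrite -{2}[n]npairK.
by apply: evals_pair; exists 1.
Qed.

Lemma ci_fst f : ci f -> ci (fun x => nfst (f x)).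
Proof. by apply: (@ci_comp nfst); exists CFst => n; exists 1. Qed.

Lemma ci_snd f : ci f -> ci (fun x => nsnd (f x)).
Proof. by apply: (@ci_comp nsnd); exists CSnd => n; exists 1. Qed.

Lemma ci_succ f : ci f -> ci (fun x => (f x).+1).
Proof. by apply: (@ci_comp succn); exists CSucc => n; exists 1. Qed.

Lemma ci_const k : ci (fun _ => k).
Proof.
elim: k => [|k IH]; last exact: (ci_succ IH).
by exists CZero => n; exists 1.
Qed.

Lemma di_oracle f : ci f -> di (fun x => f x \in A).
Proof. by apply: (@ci_comp (char_fun A)); exists COracle => n; exists 1. Qed.

Lemma ci_nrec b s n : ci b ->
  ci (fun y => s (nfst y) (nfst (nsnd y)) (nsnd (nsnd y))) -> ci n ->
  ci (fun x => nrec (b x) (s x) (n x)).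
Proof.
move=> [cb bP] [cs sP] cn.
pose f y := nrec (b (nfst y)) (s (nfst y)) (nsnd y).
suff cf : ci f.
  apply: ci_ext (ci_comp cf (ci_pair ci_id cn)) _ => x.
  by rewrite /f nfstK nsndK.
exists (CPrec cb cs) => y; rewrite -{1}[y]npairK /f.
move: (nfst y) (nsnd y) => x; elim=> [|m [k kP]].
  by have [k kP] := bP x; exists k.+1; rewrite /= nsndK nfstK.
have [l lP] := sP (npair x (npair m (nrec (b x) (s x) m))).
move: lP; rewrite /= !(nfstK, nsndK) => lP.
exists (maxn k l).+1; rewrite /= nsndK nfstK.
by rewrite (eval_leq (leq_maxl k l) kP) (eval_leq (leq_maxr k l) lP).
Qed.

Lemma di_if (p : nat -> bool) f g : di p -> ci f -> ci g ->
  ci (fun x => if p x then f x else g x).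
Proof.
move=> cp cf cg.
apply: ci_ext (@ci_nrec g (fun x _ _ => f x) (fun x => nat_of_bool (p x)) cg _ cp) _.
  exact: ci_comp cf (ci_fst ci_id).
by move=> x; case: (p x).
Qed.

Lemma ci_nat f : di f -> ci (fun x => nat_of_bool (f x)). Proof. by []. Qed.

Lemma di_neg (p : nat -> bool) : di p -> di (fun x => ~~ p x).
Proof.
move=> cp; apply: ci_ext (di_if cp (ci_const 0) (ci_const 1)) _ => x.
by case: (p x).
Qed.

Lemma di_and (p q : nat -> bool) : di p -> di q -> di (fun x => p x && q x).
Proof.
move=> cp cq; apply: ci_ext (di_if cp cq (ci_const 0)) _ => x.
by case: (p x).
Qed.

Lemma di_or (p q : nat -> bool) : di p -> di q -> di (fun x => p x || q x).
Proof.
move=> cp cq; apply: ci_ext (di_if cp (ci_const 1) cq) _ => x.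
by case: (p x).
Qed.

Lemma di_imp (p q : nat -> bool) : di p -> di q -> di (fun x => p x ==> q x).
Proof.
move=> cp cq; apply: ci_ext (di_if cp cq (ci_const 1)) _ => x.
by case: (p x).
Qed.

Lemma di_ite (p q r : nat -> bool) : di p -> di q -> di r ->
  di (fun x => if p x then q x else r x).
Proof.
move=> cp cq cr; apply: ci_ext (di_if cp cq cr) _ => x.
by case: (p x).
Qed.

Lemma ci_pred f : ci f -> ci (fun x => (f x).-1).
Proof.
move=> cf; apply: ci_ext (@ci_nrec (fun _ => 0) (fun _ m _ => m) _ (ci_const 0) _ cf) _.
  exact: ci_fst (ci_snd ci_id).
by move=> x; case: (f x).
Qed.

Lemma ci_add f g : ci f -> ci g -> ci (fun x => f x + g x).
Proof.
move=> cf cg; apply: ci_ext (@ci_nrec f (fun _ _ r => r.+1) _ cf _ cg) _.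
  exact: ci_succ (ci_snd (ci_snd ci_id)).
by move=> x; elim: (g x) => [|m IH] /=; rewrite ?addn0 // IH addnS.
Qed.

Lemma ci_sub f g : ci f -> ci g -> ci (fun x => f x - g x).
Proof.
move=> cf cg; apply: ci_ext (@ci_nrec f (fun _ _ r => r.-1) _ cf _ cg) _.
  exact: ci_pred (ci_snd (ci_snd ci_id)).
by move=> x; elim: (g x) => [|m IH] /=; rewrite ?subn0 // IH subnS.
Qed.

Lemma ci_mul f g : ci f -> ci g -> ci (fun x => f x * g x).
Proof.
move=> cf cg.
apply: ci_ext (@ci_nrec (fun _ => 0) (fun x _ r => r + f x) _ (ci_const 0) _ cg) _.
  by apply: ci_add; [exact: ci_snd (ci_snd ci_id)|exact: ci_comp cf (ci_fst ci_id)].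
by move=> x; elim: (g x) => [|m IH] /=; rewrite ?muln0 // IH mulnS addnC.
Qed.

Lemma di_leq f g : ci f -> ci g -> di (fun x => f x <= g x).
Proof.
move=> cf cg.
apply: ci_ext (@ci_nrec (fun _ => 1) (fun _ _ _ => 0) _ (ci_const 1) (ci_const 0)
  (ci_sub cf cg)) _ => x.
by rewrite -subn_eq0; case: (f x - g x).
Qed.

Lemma di_eq f g : ci f -> ci g -> di (fun x => f x == g x).
Proof.
move=> cf cg; apply: ci_ext (di_and (di_leq cf cg) (di_leq cg cf)) _ => x.
by rewrite -eqn_leq.
Qed.

Lemma ci_div f d : 0 < d -> ci f -> ci (fun x => f x %/ d).
Proof.
move=> d0 cf.
apply: ci_ext (@ci_nrec (fun _ => 0)
   (fun x _ r => if r.+1 * d <= f x then r.+1 else r) _ (ci_const 0) _ cf) _.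
  have cr := ci_snd (ci_snd ci_id).
  apply: di_if => //; last exact: ci_succ.
  apply: di_leq; last exact: ci_comp cf (ci_fst ci_id).
  by apply: ci_mul; [exact: ci_succ|exact: ci_const].
move=> x; set N := f x.
(* The candidate grows by one per round until it reaches the quotient, and [N] rounds are enough. *)
have H m : nrec 0 (fun _ r => if r.+1 * d <= N then r.+1 else r) m = minn m (N %/ d).
  elim: m => [|m IH] /=; first by rewrite min0n.
  by rewrite IH -leq_divRL //; move: (N %/ d) => Q; case: ifP; lia.
by rewrite H; apply/minn_idPr; apply: leq_div.
Qed.

Lemma ci_mod f d : 0 < d -> ci f -> ci (fun x => f x %% d).
Proof.
move=> d0 cf.
apply: ci_ext (ci_sub cf (ci_mul (ci_div d0 cf) (ci_const d))) _ => x.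
by rewrite {1}(divn_eq (f x) d); lia.
Qed.

Lemma ci_max f g : ci f -> ci g -> ci (fun x => maxn (f x) (g x)).
Proof.
move=> cf cg; apply: ci_ext (di_if (di_leq (ci_succ cf) cg) cg cf) _ => x.
by rewrite /maxn.
Qed.

Definition ball (n : nat) (p : nat -> bool) : bool := all p (iota 0 n).

Lemma ballP n (p : nat -> bool) : reflect (forall i, i < n -> p i) (ball n p).
Proof.
apply: (iffP allP) => H i; first by move=> lin; apply: H; rewrite mem_iota.
by rewrite mem_iota => /H.
Qed.

Lemma di_ball n (p : nat -> nat -> bool) : ci n ->
  di (fun y => p (nfst y) (nsnd y)) -> di (fun x => ball (n x) (p x)).
Proof.
move=> cn cp.
apply: ci_ext (@ci_nrec (fun _ => 1) (fun x i r => if p x i then r else 0)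
  _ (ci_const 1) _ cn) _.
  apply: di_if; [|exact: ci_snd (ci_snd ci_id)|exact: ci_const].
  have c := ci_comp cp (ci_pair (ci_fst ci_id) (ci_fst (ci_snd ci_id))).
  by apply: ci_ext c _ => y; rewrite nfstK nsndK.
move=> x; rewrite /ball; elim: (n x) => [//|m IH].
have -> : iota 0 m.+1 = iota 0 m ++ [:: m] by rewrite -addn1 iotaD.
rewrite all_cat /= IH andbT.
by case: (p x m); rewrite ?andbT ?andbF.
Qed.

Lemma ci_iter (s : nat -> nat -> nat) n b : ci b -> ci n ->
  ci (fun y => s (nfst y) (nsnd y)) -> ci (fun x => iter (n x) (s x) (b x)).
Proof.
move=> cb cn cs.
apply: ci_ext (@ci_nrec b (fun x _ r => s x r) n cb _ cn) _.
  have c := ci_comp cs (ci_pair (ci_fst ci_id) (ci_snd (ci_snd ci_id))).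
  by apply: ci_ext c _ => y; rewrite nfstK nsndK.
by move=> x; elim: (n x) => //= m ->.
Qed.

Lemma ci_mu (p : nat -> nat -> bool) :
  di (fun y => p (nfst y) (nsnd y)) -> (forall x, exists m, p x m) ->
  exists f, ci f /\ forall x, p x (f x) /\ forall m, p x m -> f x <= m.
Proof.
move=> cp ex; exists (fun x => ex_minn (ex x)); split; last first.
  by move=> x; case: ex_minnP.
have [c cP] := di_neg cp.
suff [d dP] : exists d, forall x, evals A d (npair x 0) (ex_minn (ex x)).
  have cm : ci (fun x => npair x 0) by apply: ci_pair; [exact: ci_id|exact: ci_const].
  have [e eP] := cm.
  by exists (CComp d e) => x; apply: evals_comp (eP x) (dP x).
exists (CMu c) => x; case: ex_minnP => m pm min.
(* The induction runs downwards from the solution [m], because [CMu] calls itself at the next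
   argument. *)
have H j : j <= m -> evals A (CMu c) (npair x (m - j)) m.
  elim: j => [_|j IH ltj].
    have [k kP] := cP (npair x (m - 0)); exists k.+1; move: kP.
    by rewrite /= !(nfstK, nsndK) subn0 pm /= => ->.
  have [k kP] := IH (ltnW ltj); have [l lP] := cP (npair x (m - j.+1)).
  exists (maxn k l).+1; rewrite /= (eval_leq (leq_maxr k l) lP) !(nfstK, nsndK).
  have -> : p x (m - j.+1) = false by apply/negP => /min; lia.
  by rewrite /= -subSn // subSS (eval_leq (leq_maxl k l) kP).
by have := H m (leqnn m); rewrite subnn.
Qed.

Lemma ci_comp2 (f : nat -> nat -> nat) g h : ci (fun y => f (nfst y) (nsnd y)) ->
  ci g -> ci h -> ci (fun x => f (g x) (h x)).
Proof.
move=> cf cg ch; apply: ci_ext (ci_comp cf (ci_pair cg ch)) _ => x.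
by rewrite nfstK nsndK.
Qed.

Lemma ci_comp3 (f : nat -> nat -> nat -> nat) g h k :
  ci (fun y => f (nfst y) (nfst (nsnd y)) (nsnd (nsnd y))) ->
  ci g -> ci h -> ci k -> ci (fun x => f (g x) (h x) (k x)).
Proof.
move=> cf cg ch ck; apply: ci_ext (ci_comp cf (ci_pair cg (ci_pair ch ck))) _ => x.
by rewrite !(nfstK, nsndK).
Qed.

End Closure.

Create HintDb ci discriminated.
#[export] Hint Constants Opaque : ci.
#[export] Hint Resolve ci_id ci_const : ci.
#[export] Hint Resolve ci_fst ci_snd ci_succ ci_pred ci_pair ci_add ci_sub
  ci_mul ci_max ci_nat di_if di_ite di_neg di_and di_or di_imp di_leq di_eq di_ball ci_iter
  di_oracle : ci.

Ltac ci := auto 60 with ci.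

(** * Strings of natural numbers *)

(* A string is the natural number coding it, with 0 for the empty string;     *)
(* [up i z] drops the last [i] entries of [z] and [pre f l] is the            *)
(* restriction of [f] to [{0, ..., l - 1}].                                   *)
Definition snoc (z x : nat) : nat := (npair x z).+1.
Definition top (z : nat) : nat := nfst z.-1.
Definition parent (z : nat) : nat := nsnd z.-1.
Definition up (i z : nat) : nat := iter i parent z.
Definition len (z : nat) : nat :=
  nrec 0 (fun i r => if up i z == 0 then r else r.+1) z.
Definition get (z i : nat) : nat := top (up (len z - i.+1) z).
Definition pre (f : nat -> nat) (l : nat) : nat :=
  nrec 0 (fun i r => snoc r (f i)) l.

Section ComputableStrings.
Variable A : set nat.
Local Notation ci := (computable_in A).
Local Notation di := (decidable_in A).

Lemma ci_snoc f g : ci f -> ci g -> ci (fun x => snoc (f x) (g x)).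
Proof. by rewrite /snoc; auto with ci. Qed.

Lemma ci_top f : ci f -> ci (fun x => top (f x)).
Proof. by rewrite /top; auto with ci. Qed.

Lemma ci_parent f : ci f -> ci (fun x => parent (f x)).
Proof. by rewrite /parent; auto with ci. Qed.

Lemma ci_up f g : ci f -> ci g -> ci (fun x => up (f x) (g x)).
Proof.
move=> cf cg; apply: ci_iter => //.
by apply: ci_parent; auto with ci.
Qed.

Lemma ci_len f : ci f -> ci (fun x => len (f x)).
Proof.
apply: (@ci_comp _ len); rewrite /len.
apply: (@ci_nrec _ (fun _ => 0) (fun z i r => if up i z == 0 then r else r.+1));
  auto with ci.
by apply: di_if; auto with ci; apply: di_eq; auto with ci; apply: ci_up; auto with ci.
Qed.

Lemma ci_get f g : ci f -> ci g -> ci (fun x => get (f x) (g x)).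
Proof.
move=> cf cg; rewrite /get; apply: ci_top; apply: ci_up => //.
by apply: ci_sub; auto with ci; apply: ci_len.
Qed.

End ComputableStrings.

#[export] Hint Resolve ci_snoc ci_top ci_parent ci_up ci_len ci_get : ci.

Lemma top_snoc z x : top (snoc z x) = x. Proof. exact: nfstK. Qed.

Lemma parent_snoc z x : parent (snoc z x) = z. Proof. exact: nsndK. Qed.

Lemma parent0 : parent 0 = 0.
Proof. by apply/eqP; rewrite -leqn0; apply: (nsnd_leq 0). Qed.

Lemma snocK z : 0 < z -> snoc (parent z) (top z) = z.
Proof. by case: z => // z _; rewrite /snoc /parent /top /= npairK. Qed.

Lemma parent_leq z : parent z <= z.-1. Proof. exact: nsnd_leq. Qed.

Lemma up0 i : up i 0 = 0.
Proof. by elim: i => //= i; rewrite /up => ->; exact: parent0. Qed.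

Lemma upS i z : up i.+1 z = up i (parent z). Proof. exact: iterSr. Qed.

Lemma up_leq i z : up i z <= z - i.
Proof.
elim: i => [|i IH]; first by rewrite subn0.
by rewrite /up iterS -/(up i z); have := parent_leq (up i z); lia.
Qed.

Lemma string_ind (P : nat -> Prop) :
  P 0 -> (forall z x, P z -> P (snoc z x)) -> forall z, P z.
Proof.
move=> P0 PS z; have [n] := ubnP z; elim: n z => // n IH [//|z] lt.
rewrite -(snocK (isT : 0 < z.+1)); apply: PS; apply: IH.
by have := parent_leq z.+1; lia.
Qed.

Lemma len0 : len 0 = 0. Proof. by []. Qed.

(** The recursion in [len] takes the code itself as number of rounds. This is harmless, since rounds
    beyond the code only meet the empty string. *)
Lemma len_snoc z x : len (snoc z x) = (len z).+1.
Proof.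
pose lenb B z := nrec 0 (fun i r => if up i z == 0 then r else r.+1) B.
have lenbE B w : lenb B.+1 w = if up B w == 0 then lenb B w else (lenb B w).+1.
  by [].
have lenbS B : lenb B.+1 (snoc z x) = (lenb B z).+1.
  by elim: B => [//|B IH]; rewrite lenbE upS parent_snoc IH lenbE; case: ifP.
have lenb_stable B : lenb (B + z) z = lenb z z.
  elim: B => [//|B IH]; rewrite addSn lenbE IH.
  by have := up_leq (B + z) z; case: eqP => //; lia.
rewrite -[len _]/(lenb (npair x z).+1 _) lenbS.
have := nsnd_leq (npair x z); rewrite nsndK => le.
by rewrite -(subnK le) lenb_stable.
Qed.

Lemma len_parent z : 0 < z -> len z = (len (parent z)).+1.
Proof. by move=> z0; rewrite -{1}(snocK z0) len_snoc. Qed.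

Lemma len_eq0 z : (len z == 0) = (z == 0).
Proof. by case: (posnP z) => [->//|z0]; rewrite len_parent //; lia. Qed.

Lemma len_leq z : len z <= z.
Proof.
elim/string_ind: z => // z x IH; rewrite len_snoc /snoc ltnS.
by apply: leq_trans IH _; rewrite -{1}(nsndK x z); apply: nsnd_leq.
Qed.

Lemma len_up i z : len (up i z) = len z - i.
Proof.
elim: i => [|i IH]; first by rewrite subn0.
rewrite /= -/(up i z); case: (posnP (up i z)) => [E|]; last first.
  by move/len_parent; rewrite IH; lia.
by move: IH; rewrite E parent0 len0; lia.
Qed.

Lemma up_len z : up (len z) z = 0.
Proof. by apply/eqP; rewrite -len_eq0 len_up subnn. Qed.

Lemma get_snoc z x i : get (snoc z x) i = if i < len z then get z i else x.
Proof.
rewrite /get len_snoc subSS; case: ltnP => lt.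
  by rewrite (_ : len z - i = (len z - i.+1).+1); [rewrite upS parent_snoc|lia].
by rewrite (_ : len z - i = 0); [rewrite /= top_snoc|lia].
Qed.

Lemma preS f l : pre f l.+1 = snoc (pre f l) (f l). Proof. by []. Qed.

Lemma len_pre f l : len (pre f l) = l.
Proof. by elim: l => //= l IH; rewrite len_snoc IH. Qed.

Lemma get_pre f l i : i < l -> get (pre f l) i = f i.
Proof.
elim: l => // l IH; rewrite ltnS get_snoc len_pre => le.
by case: ltnP => lt; [exact: IH|congr f; lia].
Qed.

Lemma eq_pre f g l : (forall i, i < l -> f i = g i) -> pre f l = pre g l.
Proof.
elim: l => // l IH H; rewrite !preS H // IH // => i lt.
by apply: H; lia.
Qed.

Lemma pre_get z : pre (get z) (len z) = z.
Proof.
elim/string_ind: z => // z x IH; rewrite len_snoc preS.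
rewrite get_snoc ltnn; congr snoc; rewrite -[RHS]IH.
by apply: eq_pre => i lt; rewrite get_snoc lt.
Qed.

Lemma string_eq z w : len z = len w -> (forall i, i < len z -> get z i = get w i) ->
  z = w.
Proof.
by move=> El Eg; rewrite -(pre_get z) -(pre_get w) -El; apply: eq_pre.
Qed.

Lemma up_pre f l i : up i (pre f l) = pre f (l - i).
Proof.
elim: i => [|i IH]; first by rewrite subn0.
rewrite /= -/(up i _) IH; case E: (l - i) => [|m].
  by rewrite (_ : l - i.+1 = 0) ?parent0 //; lia.
by rewrite /= parent_snoc; congr (pre f); lia.
Qed.

Lemma up_lenB z i : i <= len z -> up (len z - i) z = pre (get z) i.
Proof.
by move=> le; rewrite -{2}(pre_get z) up_pre; congr pre; lia.
Qed.

Definition extends (p q : nat) : bool :=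
  (len p <= len q) && (up (len q - len p) q == p).

Lemma extendsP p q : reflect
  (len p <= len q /\ forall i, i < len p -> get q i = get p i) (extends p q).
Proof.
apply: (iffP andP) => -[le] H; split=> //.
  move=> i lt; have -> : get p i = get (up (len q - len p) q) i by rewrite (eqP H).
  by rewrite up_lenB // get_pre.
rewrite up_lenB // -[X in _ == X](pre_get p); apply/eqP.
exact: eq_pre.
Qed.

Lemma extends_refl p : extends p p. Proof. exact/extendsP. Qed.

Lemma extends_trans p q r : extends p q -> extends q r -> extends p r.
Proof.
move=> /extendsP[l1 H1] /extendsP[l2 H2]; apply/extendsP; split; first by lia.
by move=> i lt; rewrite H2 ?H1 //; lia.
Qed.

Lemma extends_snoc p x : extends p (snoc p x).
Proof.
by apply/extendsP; rewrite len_snoc; split=> // i lt; rewrite get_snoc lt.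
Qed.

Lemma extends_pre f l m : l <= m -> extends (pre f l) (pre f m).
Proof.
move=> le; apply/extendsP; rewrite !len_pre; split=> // i lt.
by rewrite !get_pre //; lia.
Qed.

Lemma extends_get x y : extends x y -> len x < len y ->
  extends (snoc x (get y (len x))) y.
Proof.
move=> /extendsP[le Eg] lt; apply/extendsP; rewrite len_snoc; split=> // i li.
by rewrite get_snoc; case: ltnP => lt'; [exact: Eg|congr get; lia].
Qed.

Lemma di_extends A f g : computable_in A f -> computable_in A g ->
  decidable_in A (fun x => extends (f x) (g x)).
Proof. by rewrite /extends; ci. Qed.
#[export] Hint Resolve di_extends : ci.

Definition haspath (T : nat -> bool) : Prop :=
  exists f : nat -> nat, forall l, T (pre f l).

(** * Evaluation with a partial oracle, and its computability *)

(* [o n = v.+1] means that the oracle answers [v], and [o n = 0] that it      *)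
(* gives no answer, in which case the computation is aborted.                 *)
Fixpoint evalp (k : nat) (o : nat -> nat) (c : code) (n : nat) : option nat :=
  if k is k'.+1 then
    match c with
    | CZero => Some 0
    | CSucc => Some n.+1
    | CFst => Some (nfst n)
    | CSnd => Some (nsnd n)
    | COracle => if o n is v.+1 then Some v else None
    | CPair a b =>
        if evalp k' o a n is Some x then
          if evalp k' o b n is Some y then Some (npair x y) else None
        else None
    | CComp a b => if evalp k' o b n is Some x then evalp k' o a x else None
    | CPrec a b =>
        if nsnd n is m.+1 then
          if evalp k' o c (npair (nfst n) m) is Some r then
            evalp k' o b (npair (nfst n) (npair m r))
          else None
        else evalp k' o a (nfst n)
    | CMu a =>
        match evalp k' o a n with
        | Some 0 => Some (nsnd n)
        | Some _.+1 => evalp k' o c (npair (nfst n) (nsnd n).+1)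
        | None => None
        end
    end
  else None.

Lemma evalp_leq k l (o o' : nat -> nat) c n m : k <= l ->
  (forall z, 0 < o z -> o' z = o z) ->
  evalp k o c n = Some m -> evalp l o' c n = Some m.
Proof.
move=> kl oo; elim: k l c n m kl => [//|k IH] [//|l] c n m; rewrite ltnS => /IH{}IH.
case: c => //= [|a b|a b|a b|a].
- by have := oo n; case: (o n) => // v ->.
- case Ea: (evalp k o a n) => [x|//]; case Eb: (evalp k o b n) => [y|//].
  by rewrite (IH _ _ _ Ea) (IH _ _ _ Eb).
- case Eb: (evalp k o b n) => [x|//]; rewrite (IH _ _ _ Eb); exact: IH.
- case: (nsnd n) => [|i]; first exact: IH.
  case Ec: (evalp k _ _ _) => [x|//]; rewrite (IH _ _ _ Ec); exact: IH.
- case Ea: (evalp k o a n) => [[|x]|//]; rewrite (IH _ _ _ Ea) //; exact: IH.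
Qed.

Lemma evalp_total k A c n : evalp k (fun z => (char_fun A z).+1) c n = eval k A c n.
Proof.
elim: k c n => [//|k IH] c n; case: c => //= [a b|a b|a b|a]; rewrite ?IH.
- by case: (eval k A a n) => // x; rewrite IH.
- by case: (eval k A b n) => // x; rewrite IH.
- by case: (nsnd n) => [|i]; rewrite ?IH //; case: (eval k A _ _) => // x; rewrite IH.
- by case: (eval k A a n) => // -[|x]; rewrite ?IH.
Qed.

Lemma evalp_compact (os : nat -> nat -> nat) o k c n m :
  (forall l l' z, l <= l' -> 0 < os l z -> os l' z = os l z) ->
  (forall z, 0 < o z -> exists l, os l z = o z) ->
  evalp k o c n = Some m -> exists l, evalp k (os l) c n = Some m.
Proof.
move=> mono lim.
have up k' c' n' m' l l' : l <= l' -> evalp k' (os l) c' n' = Some m' ->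
    evalp k' (os l') c' n' = Some m'.
  by move=> le; apply: evalp_leq => // z; apply: mono.
elim: k c n m => [//|k IH] c n m; case: c => //=.
- have := lim n; case: (o n) => // v /(_ isT)[l El] [<-].
  by exists l; rewrite El.
- move=> a b; case Ea: (evalp k o a n) => [x|//].
  case Eb: (evalp k o b n) => [y|//] E.
  have [l1 H1] := IH _ _ _ Ea; have [l2 H2] := IH _ _ _ Eb.
  exists (maxn l1 l2).
  by rewrite (up _ _ _ _ _ _ (leq_maxl _ _) H1) (up _ _ _ _ _ _ (leq_maxr _ _) H2).
- move=> a b; case Eb: (evalp k o b n) => [x|//] Ea.
  have [l1 H1] := IH _ _ _ Ea; have [l2 H2] := IH _ _ _ Eb.
  exists (maxn l1 l2).
  by rewrite (up _ _ _ _ _ _ (leq_maxr _ _) H2) (up _ _ _ _ _ _ (leq_maxl _ _) H1).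
- move=> a b; case: (nsnd n) => [|i]; first exact: IH.
  case Eb: (evalp k o _ _) => [x|//] Ea.
  have [l1 H1] := IH _ _ _ Ea; have [l2 H2] := IH _ _ _ Eb.
  exists (maxn l1 l2).
  by rewrite (up _ _ _ _ _ _ (leq_maxr _ _) H2) (up _ _ _ _ _ _ (leq_maxl _ _) H1).
- move=> a; case Eb: (evalp k o _ _) => [[|x]|//] Ea.
    by have [l H] := IH _ _ _ Eb; exists l; rewrite H.
  have [l1 H1] := IH _ _ _ Ea; have [l2 H2] := IH _ _ _ Eb.
  exists (maxn l1 l2).
  by rewrite (up _ _ _ _ _ _ (leq_maxr _ _) H2) (up _ _ _ _ _ _ (leq_maxl _ _) H1).
Qed.

(* A stack machine for [evalp].  A state consists of a stack of tasks and a   *)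
(* value, which is 0 when the computation has been aborted and [v.+1] when    *)
(* the last task has returned [v].  The task [task 0 k c n] asks for the      *)
(* evaluation of the program [c] on [n] with fuel [k]; the others are the     *)
(* continuations for [CPair] (1 and 2), [CComp], [CPrec] and [CMu].           *)
Definition task (tag k c n : nat) : nat := npair tag (npair k (npair c n)).

Definition step (o : nat -> nat) (st : nat) : nat :=
  if (nfst st == 0) || (nsnd st == 0) then st else
  let t := top (nfst st) in
  let K := parent (nfst st) in
  let x := (nsnd st).-1 in
  let tag := nfst t in
  let k := nfst (nsnd t) in
  let c := nfst (nsnd (nsnd t)) in
  let n := nsnd (nsnd (nsnd t)) in
  if tag == 0 then
    if k == 0 then npair K 0 else
    if c == 0 then npair K 1 else
    if c == 1 then npair K n.+2 else
    if c == 2 then npair K (nfst n).+1 else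
    if c == 3 then npair K (nsnd n).+1 else
    if c == 4 then npair K (o n) else
    let q := (c - 5) %/ 4 in
    let r := (c - 5) %% 4 in
    if r == 0 then
      npair (snoc (snoc K (task 1 k.-1 (nsnd q) n)) (task 0 k.-1 (nfst q) n)) 1
    else if r == 1 then
      npair (snoc (snoc K (task 3 k.-1 (nfst q) 0)) (task 0 k.-1 (nsnd q) n)) 1
    else if r == 2 then
      if nsnd n == 0 then npair (snoc K (task 0 k.-1 (nfst q) (nfst n))) 1
      else npair (snoc (snoc K (task 4 k.-1 (nsnd q) n))
                   (task 0 k.-1 c (npair (nfst n) (nsnd n).-1))) 1
    else npair (snoc (snoc K (task 5 k.-1 c n)) (task 0 k.-1 q n)) 1
  else if tag == 1 then npair (snoc (snoc K (task 2 0 0 x)) (task 0 k c n)) 1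
  else if tag == 2 then npair K (npair n x).+1
  else if tag == 3 then npair (snoc K (task 0 k c x)) 1
  else if tag == 4 then
    npair (snoc K (task 0 k c (npair (nfst n) (npair (nsnd n).-1 x)))) 1
  else if x == 0 then npair K (nsnd n).+1
  else npair (snoc K (task 0 k c (npair (nfst n) (nsnd n).+1))) 1.

Lemma ci_step A (o : nat -> nat -> nat) f g :
  computable_in A (fun y => o (nfst y) (nsnd y)) ->
  computable_in A f -> computable_in A g ->
  computable_in A (fun x => step (o (f x)) (g x)).
Proof.
move=> co cf cg; apply: (@ci_comp2 _ (fun w st => step (o w) st)) => // {f g cf cg}.
have co2 f g : computable_in A f -> computable_in A g ->
  computable_in A (fun x => o (f x) (g x)) by apply: ci_comp2.
have cd f : computable_in A f -> computable_in A (fun x => f x %/ 4) by exact: ci_div.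
have cm f : computable_in A f -> computable_in A (fun x => f x %% 4) by exact: ci_mod.
by rewrite /step /task; auto 100 with ci.
Qed.

Section MachineCorrect.
Variable o : nat -> nat.

Definition reach (st st' : nat) : Prop := exists j, iter j (step o) st = st'.

Lemma reach_refl st : reach st st. Proof. by exists 0. Qed.

Lemma reach_trans st1 st2 st3 : reach st1 st2 -> reach st2 st3 -> reach st1 st3.
Proof. by move=> [i Ei] [j Ej]; exists (j + i); rewrite iterD Ei. Qed.

Lemma reach_step st1 st2 : reach (step o st1) st2 -> reach st1 st2.
Proof. by move=> [i Ei]; exists i.+1; rewrite iterSr. Qed.

Definition reach_result (st K : nat) (r : option nat) : Prop :=
  if r is Some m then reach st (npair K m.+1) else exists K', reach st (npair K' 0).

Lemma reach_result_trans st1 st2 K r :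
  reach st1 st2 -> reach_result st2 K r -> reach_result st1 K r.
Proof.
case: r => [m|] /= H; first exact: reach_trans.
by move=> [K' H']; exists K'; apply: reach_trans H'.
Qed.

Lemma stepE K tag k c n v : step o (npair (snoc K (task tag k c n)) v.+1) =
  if tag == 0 then
    if k == 0 then npair K 0 else
    if c == 0 then npair K 1 else
    if c == 1 then npair K n.+2 else
    if c == 2 then npair K (nfst n).+1 else
    if c == 3 then npair K (nsnd n).+1 else
    if c == 4 then npair K (o n) else
    let q := (c - 5) %/ 4 in
    let r := (c - 5) %% 4 in
    if r == 0 then
      npair (snoc (snoc K (task 1 k.-1 (nsnd q) n)) (task 0 k.-1 (nfst q) n)) 1
    else if r == 1 then
      npair (snoc (snoc K (task 3 k.-1 (nfst q) 0)) (task 0 k.-1 (nsnd q) n)) 1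
    else if r == 2 then
      if nsnd n == 0 then npair (snoc K (task 0 k.-1 (nfst q) (nfst n))) 1
      else npair (snoc (snoc K (task 4 k.-1 (nsnd q) n))
                   (task 0 k.-1 c (npair (nfst n) (nsnd n).-1))) 1
    else npair (snoc (snoc K (task 5 k.-1 c n)) (task 0 k.-1 q n)) 1
  else if tag == 1 then npair (snoc (snoc K (task 2 0 0 v)) (task 0 k c n)) 1
  else if tag == 2 then npair K (npair n v).+1
  else if tag == 3 then npair (snoc K (task 0 k c v)) 1
  else if tag == 4 then
    npair (snoc K (task 0 k c (npair (nfst n) (npair (nsnd n).-1 v)))) 1
  else if v == 0 then npair K (nsnd n).+1
  else npair (snoc K (task 0 k c (npair (nfst n) (nsnd n).+1))) 1.
Proof.
by rewrite /step !(nfstK, nsndK) /= top_snoc parent_snoc /task !(nfstK, nsndK).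
Qed.

Lemma code4E q r : r < 4 -> (5 + (q * 4 + r) - 5) %/ 4 = q /\
  (5 + (q * 4 + r) - 5) %% 4 = r.
Proof.
move=> lr; rewrite addKn divnMDl // divn_small // addn0 modnMDl modn_small //.
Qed.

(** The stack [K] is arbitrary so that the induction hypothesis applies to subcomputations with a
    continuation waiting below them. *)
Lemma machine_correct k c n K v :
  reach_result (npair (snoc K (task 0 k (encode c) n)) v.+1) K (evalp k o c n).
Proof.
elim: k c n K v => [|k IH] c n K v.
  by exists K; apply: reach_step; rewrite stepE; apply: reach_refl.
have chn c1 n1 K1 v1 (rest : nat -> option nat) K2 :
   (forall m, reach_result (npair K1 m.+1) K2 (rest m)) ->
   reach_result (npair (snoc K1 (task 0 k (encode c1) n1)) v1.+1) K2
     (if evalp k o c1 n1 is Some m then rest m else None).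
  move=> H; have := IH c1 n1 K1 v1; case: (evalp k o c1 n1) => //= m Hm.
  exact: reach_result_trans Hm (H m).
apply: reach_result_trans (reach_step (reach_refl _)) _.
rewrite stepE [_ == 0]/= [k.+1 == 0]/= [k.+1.-1]/=.
case: c => [|||||a b|a b|a b|a].
- exact: reach_refl.
- exact: reach_refl.
- exact: reach_refl.
- exact: reach_refl.
- rewrite /=; case: (o n) => [|w]; last exact: reach_refl.
  by exists K; apply: reach_refl.
- rewrite [encode _]/=; have [-> ->] := @code4E (npair (encode a) (encode b)) 0 isT.
  rewrite /= nfstK nsndK; apply: (chn) => x.
  apply: reach_result_trans (reach_step (reach_refl _)) _; rewrite stepE /=.
  apply: (chn) => y.
  apply: reach_result_trans (reach_step (reach_refl _)) _; rewrite stepE /=.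
  exact: reach_refl.
- rewrite [encode _]/=; have [-> ->] := @code4E (npair (encode a) (encode b)) 1 isT.
  rewrite /= nfstK nsndK; apply: (chn) => x.
  apply: reach_result_trans (reach_step (reach_refl _)) _; rewrite stepE /=.
  exact: (IH).
- rewrite [encode _]/=; have [-> ->] := @code4E (npair (encode a) (encode b)) 2 isT.
  rewrite /= nfstK nsndK; case En: (nsnd n) => [|i] /=; first exact: IH.
  apply: (chn (CPrec a b)) => x.
  apply: reach_result_trans (reach_step (reach_refl _)) _; rewrite stepE /= En /=.
  exact: (IH).
- rewrite [encode _]/=; have [-> ->] := @code4E (encode a) 3 isT.
  rewrite [_ == 0]/= /=.
  have H x : reach_result (npair (snoc K (task 5 k (5 + (encode a * 4 + 3)) n)) x.+1) K
      (if x is _.+1 then evalp k o (CMu a) (npair (nfst n) (nsnd n).+1)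
       else Some (nsnd n)).
    apply: reach_result_trans (reach_step (reach_refl _)) _; rewrite stepE.
    by case: x => [|x]; [exact: reach_refl|exact: IH].
  have := chn a n (snoc K (task 5 k (5 + (encode a * 4 + 3)) n)) 0 _ K H.
  by case: (evalp k o a n) => [[|x]|].
Qed.

End MachineCorrect.

Definition evalo (k : nat) (o : nat -> nat) (c n : nat) : nat :=
  if evalp k o (decode c) n is Some m then m.+1 else 0.

(** The fuel makes every run of the machine stop, so the search for a final state is total even if
    the evaluated program diverges. Final states are fixed by [step]. *)
Lemma ci_evalo A (o : nat -> nat -> nat) w k c n :
  computable_in A (fun y => o (nfst y) (nsnd y)) -> computable_in A w ->
  computable_in A k -> computable_in A c -> computable_in A n ->
  computable_in A (fun x => evalo (k x) (o (w x)) (c x) (n x)).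
Proof.
move=> co cw ck cc cn.
pose init x := npair (snoc 0 (task 0 (k x) (c x) (n x))) 1.
pose run x j := iter j (step (o (w x))) (init x).
pose final st := (nfst st == 0) || (nsnd st == 0).
have crun : computable_in A (fun y => run (nfst y) (nsnd y)).
  have compf f : computable_in A f -> computable_in A (fun y => f (nfst y)).
    by move=> cf; apply: ci_comp cf _; ci.
  apply: (@ci_iter A (fun y => step (o (w (nfst y)))) nsnd (fun y => init (nfst y)));
    try by ci.
    by rewrite /init /task; ci.
  by apply: (@ci_step A o) => //; last ci; apply: ci_comp cw _; ci.
have stop x : exists m K, run x m = npair K (evalo (k x) (o (w x)) (c x) (n x)) /\
    final (run x m).
  have := machine_correct (o (w x)) (k x) (decode (c x)) (n x) 0 0.
  rewrite decodeK /reach_result /evalo.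
  case: evalp => [m [j Ej]|[K' [j Ej]]].
    by exists j, 0; rewrite /run Ej /final nfstK.
  by exists j, K'; rewrite /run Ej /final nsndK orbT.
have [||h [ch hP]] := @ci_mu A (fun x m => final (run x m)).
- by rewrite /final; auto 20 with ci.
- by move=> x; have [m [K [_ H]]] := stop x; exists m.
have c1 : computable_in A (fun x => nsnd (run x (h x))).
  by apply: ci_snd; apply: (@ci_comp2 A run) => //; ci.
apply: ci_ext c1 _ => x.
have [m [K [Em fm]]] := stop x; have [fh min] := hP x.
have le := min _ fm.
have stable j : run x (j + h x) = run x (h x).
  elim: j => // j IH; rewrite addSn /run iterS -/(run x _) IH.
  by rewrite /step -/(final _) fh.
by rewrite -(stable (m - h x)) subnK // Em nsndK.
Qed.

(** * Reductions *)

Lemma turing_leP A B : turing_le A B <-> decidable_in B (fun n => n \in A).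
Proof. by rewrite /decidable_in computable_inP. Qed.

Fixpoint subst_oracle (d c : code) : code :=
  match c with
  | COracle => d
  | CPair a b => CPair (subst_oracle d a) (subst_oracle d b)
  | CComp a b => CComp (subst_oracle d a) (subst_oracle d b)
  | CPrec a b => CPrec (subst_oracle d a) (subst_oracle d b)
  | CMu a => CMu (subst_oracle d a)
  | _ => c
  end.

Lemma evals_subst A B d : (forall n, evals B d n (char_fun A n)) ->
  forall c n m, evals A c n m -> evals B (subst_oracle d c) n m.
Proof.
move=> dP c n m [k]; elim: k c n m => [//|k IH] c n m.
case: c => [|||||a b|a b|a b|a] /=.
- by move=> E; exists 1.
- by move=> E; exists 1.
- by move=> E; exists 1.
- by move=> E; exists 1.
- by move=> [<-]; apply: dP.
- case Ea: (eval k A a n) => [x|//]; case Eb: (eval k A b n) => [y|//] [<-].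
  by apply: evals_pair; apply: IH.
- case Eb: (eval k A b n) => [x|//] Ea.
  by apply: evals_comp (IH _ _ _ Eb) (IH _ _ _ Ea).
- case En: (nsnd n) => [|i].
    by move=> /IH[l El]; exists l.+1; rewrite /= En.
  case Ec: (eval k A _ _) => [x|//] /IH[l El]; have [l' El'] := IH _ _ _ Ec.
  exists (maxn l l').+1; rewrite /= En.
  move: El' => /= /(eval_leq (leq_maxr l l')) ->.
  exact: eval_leq (leq_maxl l l') El.
- case Ea: (eval k A a n) => [[|x]|//].
    move=> [<-]; have [l El] := IH _ _ _ Ea; exists l.+1.
    by rewrite /= El.
  move=> /IH[l El]; have [l' El'] := IH _ _ _ Ea.
  exists (maxn l l').+1; rewrite /= (eval_leq (leq_maxr l l') El').
  exact: eval_leq (leq_maxl l l') El.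
Qed.

Lemma computable_in_le A B f : turing_le A B -> computable_in A f ->
  computable_in B f.
Proof.
move=> [e eP] [c cP]; exists (subst_oracle (decode e) c) => n.
exact: (evals_subst eP).
Qed.

Lemma turing_le_refl A : turing_le A A.
Proof. by apply/turing_leP; apply: di_oracle; ci. Qed.

Lemma turing_le_trans A B C : turing_le A B -> turing_le B C -> turing_le A C.
Proof.
by move=> /turing_leP AB BC; apply/turing_leP; apply: computable_in_le AB.
Qed.

Lemma turing_equiv_refl A : turing_equiv A A.
Proof. by split; apply: turing_le_refl. Qed.

Fixpoint const_code (w : nat) : code :=
  if w is w'.+1 then CComp CSucc (const_code w') else CZero.

Lemma const_codeP A w n : evals A (const_code w) n w.
Proof.
elim: w => [|w IH] /=; first by exists 1.
by apply: evals_comp IH _; exists 1.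
Qed.

(* The s-m-n function, fixing the first argument of [c].                      *)
Definition smn (c : code) (w : nat) : nat :=
  encode (CComp c (CPair (const_code w) (CPair CFst CSnd))).

Lemma smnP c w A n m : phi (smn c w) A n m <-> evals A c (npair w n) m.
Proof.
have idP : evals A (CPair CFst CSnd) n n.
  by exists 2; rewrite /= npairK.
have argP := evals_pair (const_codeP A w n) idP.
rewrite /phi /smn encodeK; split; last exact: evals_comp argP.
move=> [[//|k]] /= Ek; move: Ek.
case Ea: (eval k A _ n) => [x|//] Ek; exists k.
by rewrite (evals_fun argP (ex_intro _ k Ea)).
Qed.

Lemma ci_smn A c f : computable_in A f -> computable_in A (fun x => smn c (f x)).
Proof.
apply: (@ci_comp _ (smn c)).
pose ec w := nrec 0 (fun _ r => 5 + (npair 1 r * 4 + 1)) w.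
have ecE w : encode (const_code w) = ec w by elim: w => //= w ->.
have cec : computable_in A ec by apply: ci_nrec; ci.
have c2 : computable_in A (fun w => 5 + (npair (encode c)
  (5 + (npair (ec w) (encode (CPair CFst CSnd)) * 4 + 0)) * 4 + 1)) by ci.
by apply: ci_ext c2 _ => w; rewrite /smn -ecE.
Qed.
#[export] Hint Resolve ci_smn : ci.

Lemma computable_fun_in A f : computable_fun f -> computable_in A f.
Proof.
move=> [e eP]; apply: (@computable_in_le set0).
  by apply/turing_leP; apply: ci_ext (ci_const A 0) _ => n; rewrite in_set0.
by apply/computable_inP; exists e.
Qed.

(** The program with index [r e] ignores its input and searches for [k]. Only s-m-n is used to find
    the index, so [r] is computable without the oracle [A]. *)
Lemma sigma1_jump A (E : nat -> nat -> bool) :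
  decidable_in A (fun y => E (nfst y) (nsnd y)) ->
  exists r, (forall B, computable_in B r) /\
    forall e, r e \in jump A <-> exists k, E e k.
Proof.
move=> /di_neg[c cP].
have cE e k : evals A c (npair e k) (nat_of_bool (~~ E e k)).
  by have := cP (npair e k); rewrite nfstK nsndK.
pose d := CComp (CMu c) (CPair CFst CZero).
have argP e n : evals A (CPair CFst CZero) (npair e n) (npair e 0).
  by exists 2; rewrite /= nfstK.
have fwd e k : E e k -> exists m, evals A (CMu c) (npair e 0) m.
  move=> Ek; suff H j : j <= k -> exists m, evals A (CMu c) (npair e (k - j)) m.
    by rewrite -(subnn k); apply: H.
  elim: j => [_|j IH lt].
    exists k; have [l El] := cE e k; exists l.+1.
    by rewrite subn0 /= El Ek nsndK.
  have [m [l El]] := IH (ltnW lt); have [l' El'] := cE e (k - j.+1).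
  case: (E e (k - j.+1)) El' => El'.
    by exists (k - j.+1), l'.+1; rewrite /= El' nsndK.
  exists m, (maxn l l').+1; rewrite /= (eval_leq (leq_maxr l l') El') /=.
  rewrite nfstK nsndK -subSn // subSS; exact: eval_leq (leq_maxl l l') El.
have bwd e i m : evals A (CMu c) (npair e i) m -> exists k, E e k.
  move=> [l]; elim: l i => [//|l IH] i /=.
  case Ec: (eval l A c _) => [[|x]|//].
    move=> _; exists i; have := evals_fun (cE e i) (ex_intro _ l Ec).
    by case: (E e i).
  by rewrite nfstK => /IH.
exists (smn d); split; first by move=> B; ci.
move=> e; rewrite in_setE; split=> [[m /smnP[k]]|[k Ek]].
  case: k => // k; rewrite /d /=; case Ea: (eval k A _ _) => [x|//] Ek.
  have Ex := evals_fun (argP e (smn d e)) (ex_intro _ k Ea).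
  by apply: (bwd e 0 m); exists k; rewrite Ex.
have [m Hm] := fwd _ _ Ek; exists m; apply/smnP.
exact: evals_comp (argP _ _) Hm.
Qed.

Definition oracle (A : set nat) (z : nat) : nat := (char_fun A z).+1.

Lemma evalo_total k A e n : evalo k (oracle A) e n =
  if eval k A (decode e) n is Some m then m.+1 else 0.
Proof. by rewrite /evalo evalp_total. Qed.

Lemma phiP e A n m : phi e A n m <-> exists k, evalo k (oracle A) e n = m.+1.
Proof.
split=> [[k Ek]|[k]]; first by exists k; rewrite evalo_total Ek.
by rewrite evalo_total; case E: eval => [x|//] [<-]; exists k.
Qed.

Lemma ci_evalo_oracle A k c n : computable_in A k -> computable_in A c ->
  computable_in A n -> computable_in A (fun x => evalo (k x) (oracle A) (c x) (n x)).
Proof.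
move=> ck cc cn; apply: (@ci_evalo A (fun _ => oracle A) (fun _ => 0)); auto with ci.
apply: ci_succ; exact: (@di_oracle A nsnd (ci_snd (ci_id _))).
Qed.
#[export] Hint Resolve ci_evalo_oracle : ci.

Lemma jump_le A B : turing_le A B -> turing_le (jump A) (jump B).
Proof.
move=> AB; pose E e k := 0 < evalo k (oracle A) e e.
have cE : decidable_in A (fun y => E (nfst y) (nsnd y)) by rewrite /E; ci.
have [r [cr rP]] := sigma1_jump (computable_in_le AB cE).
apply/turing_leP; apply: ci_ext (di_oracle (cr (jump B))) _ => e; congr nat_of_bool.
apply/idP/idP => [/rP[k]|].
  rewrite /E; case El: evalo => [|m] // _; rewrite in_setE; exists m.
  by apply/phiP; exists k.
rewrite in_setE => -[m /phiP[k Ek]]; apply/rP; exists k.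
by rewrite /E Ek.
Qed.

(** * The Kleene-Brouwer ordering *)

(** The shift by one reserves 0 for positions past the end. As [vlt] ranks 0 last, a string comes
    after its proper extensions. *)
Definition kbval (z i : nat) : nat := if i < len z then (get z i).+1 else 0.

(* The order on [kbval]s, with 0 as the largest element.                      *)
Definition vlt (a b : nat) : bool := (0 < a) && ((b == 0) || (a < b)).

Definition kblt (z w : nat) : bool :=
  ~~ ball (len z) (fun i => ~~ (ball i (fun j => kbval z j == kbval w j) &&
                                vlt (kbval z i) (kbval w i))).

Lemma kbltP z w : reflect (exists i, (forall j, j < i -> kbval z j = kbval w j) /\
  vlt (kbval z i) (kbval w i)) (kblt z w).
Proof.
apply: (iffP idP) => [|[i [eqi lti]]].
  move=> /negP nb; apply: contrapT => H; apply: nb; apply/ballP => i _.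
  apply/negP => /andP[/ballP eqi lti].
  by apply: H; exists i; split=> // j lt; apply/eqP; apply: eqi.
apply/negP => /ballP H; have lt : i < len z.
  by move: lti; rewrite /vlt {1}/kbval; case: ifP.
have /negP := H _ lt; apply; rewrite lti andbT.
by apply/ballP => j lt'; apply/eqP; apply: eqi.
Qed.

Lemma kblt_irr z : kblt z z = false.
Proof. by apply/kbltP => -[i [_]]; rewrite /vlt; lia. Qed.

Lemma kblt_trans y x z : kblt x y -> kblt y z -> kblt x z.
Proof.
move=> /kbltP[i [ei li]] /kbltP[j [ej lj]]; apply/kbltP.
case: (ltngtP i j) => [lt|lt|E].
- exists i; split; last by rewrite -ej.
  by move=> k lk; rewrite ei // ej //; lia.
- exists j; split; last by rewrite ei.
  by move=> k lk; rewrite ei ?ej //; lia.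
- exists i; split; first by move=> k lk; rewrite ei // ej //; lia.
  by move: li lj; rewrite -E /vlt; lia.
Qed.

Lemma kblt_total x y : x != y -> kblt x y || kblt y x.
Proof.
move=> neq; have [i] : exists i, kbval x i != kbval y i.
  apply: contrapT => H; have E i : kbval x i = kbval y i.
    by apply/eqP; apply: contrapT => /negP ne; apply: H; exists i.
  move: neq; apply/negP; rewrite negbK; apply/eqP.
  have El : len x = len y.
    apply/eqP; case: ltngtP => // lt.
      by have := E (len x); rewrite /kbval ltnn lt.
    by have := E (len y); rewrite /kbval ltnn lt.
  apply: string_eq => // i lt; have := E i; rewrite /kbval -El lt; congruence.
have [n] := ubnP i; elim: n i => // n IH i lt ne.
case: (EM (exists j, j < i /\ kbval x j != kbval y j)) => [[j [lj nj]]|H].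
  by apply: IH nj; lia.
have eqi j : j < i -> kbval x j = kbval y j.
  by move=> lj; apply/eqP; apply: contrapT => /negP nj; apply: H; exists j.
have : vlt (kbval x i) (kbval y i) || vlt (kbval y i) (kbval x i).
  by rewrite /vlt; lia.
case/orP => v; apply/orP; [left|right]; apply/kbltP; exists i; split=> //.
by move=> j lj; rewrite eqi.
Qed.

(** The predicates [T] need not be closed under initial segments; this enforces it and keeps the
    paths. *)
Definition node (T : nat -> bool) (z : nat) : bool :=
  ball (len z).+1 (fun i => T (up i z)).

Lemma node_parent T z : node T z -> node T (parent z).
Proof.
case: (posnP z) => [->|z0]; first by rewrite parent0.
move=> /ballP H; apply/ballP => i lt; rewrite -upS; apply: H.
by move: lt; rewrite (len_parent z0).
Qed.

Lemma node_pre (T : nat -> bool) f : (forall l, T (pre f l)) -> forall l, node T (pre f l).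
Proof. by move=> H l; apply/ballP => i _; rewrite up_pre. Qed.

Lemma node_up (T : nat -> bool) z i : i <= len z -> node T z -> T (up i z).
Proof. by move=> le /ballP; apply. Qed.

(* The Kleene-Brouwer ordering of the tree of nodes of [T], on top of the     *)
(* remaining natural numbers.                                                 *)
Definition kb (T : nat -> bool) (x y : nat) : bool :=
  (x == y) || (if node T x then node T y && kblt x y else node T y || (x < y)).

Lemma kb_total T : total (kb T).
Proof.
move=> x y; rewrite /kb; case: (eqVneq x y) => //= ne.
have := kblt_total ne; case: (node T x); case: (node T y) => //=; lia.
Qed.

Lemma kb_anti T : antisymmetric (kb T).
Proof.
move=> x y; rewrite /kb; case: (eqVneq x y) => //= ne.
case: (node T x); case: (node T y) => //=; last by lia.
by move=> /andP[/kblt_trans H /H]; rewrite kblt_irr.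
Qed.

Lemma kb_trans T : transitive (kb T).
Proof.
move=> y x z; rewrite /kb; case: (eqVneq x y) => [->//|/= ne].
case: (eqVneq y z) => [->->|/= ne']; first by rewrite orbT.
case: (eqVneq x z) => //= ne''.
case: (node T x); case: (node T y); case: (node T z) => //=; try lia.
exact: kblt_trans.
Qed.

Lemma haspath_not_wo T : haspath T -> ~ wochoice.well_order (kb T).
Proof.
move=> [f fP] /(_ (fun z => `[< exists l, z = pre f l >])) [].
  by exists 0; apply/asboolP; exists 0.
move=> z [[/asboolP[l ->] H] _].
have /H : pre f l.+1 \in (fun z => `[< exists l, z = pre f l >]).
  by apply/asboolP; exists l.+1.
have lt : kb T (pre f l.+1) (pre f l).
  rewrite /kb !node_pre //; apply/orP; right; apply/kbltP; exists l; split.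
    by move=> j lj; rewrite /kbval !len_pre lj ltnS (ltnW lj) !get_pre //; lia.
  by rewrite /kbval !len_pre ltnn ltnSn.
move=> gt; have /(@kb_anti T)/(congr1 len) : kb T (pre f l.+1) (pre f l) && kb T (pre f l) (pre f l.+1).
  by rewrite lt gt.
by rewrite !len_pre; lia.
Qed.

(** A set [Z] without minimum yields a path: a string is [good] if the part of [Z] above it is
    nonempty and has no Kleene-Brouwer least element, and the leftmost child that [Z] meets inherits
    this. *)
Lemma nopath_wo T : ~ haspath T -> wochoice.well_order (kb T).
Proof.
move=> nopath; apply: wochoice.antisymmetric_well_order; first exact: kb_anti.
move=> Z [z0 Zz0]; apply: contrapT => nomin.
(* Numbers that are not nodes come first and in their usual order, so one of them in [Z] would
   provide a minimum. *)
have Znode z : z \in Z -> node T z.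
  move=> Zz; apply: contrapT => /negP nz.
  have ex : exists z, (z \in Z) && ~~ node T z by exists z; rewrite Zz.
  apply: nomin; case: (ex_minnP ex) => m /andP[Zm nm] min.
  exists m; split=> // y Zy; rewrite /kb (negPf nm).
  case ny: (node T y); first by rewrite orbT.
  by have := min y; rewrite Zy ny => /(_ isT); rewrite leq_eqVlt.
pose least S z := S z /\ forall y, S y -> y = z \/ kblt z y.
pose Zof t z := z \in Z /\ extends t z.
pose good t := (exists z, Zof t z) /\ ~ exists z, least (Zof t) z.
have good0 : good 0.
  have e0 z : extends 0 z by apply/extendsP; rewrite len0.
  split; first by exists z0.
  move=> [z [[Zz _] H]]; apply: nomin; exists z; split=> // y Zy.
  have [->|lt] := H y (conj Zy (e0 y)); first by rewrite /kb eqxx.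
  by rewrite /kb !Znode // lt orbT.
have goodS t : good t -> exists i, good (snoc t i).
  move=> [[z Zz] nl].
  have [s [[Zs ts] ls]] : exists s, Zof t s /\ len t < len s.
    apply: contrapT => H.
    have E y : Zof t y -> y = t.
      move=> [Zy /[dup] ty /extendsP[le Eg]].
      have le' : len y <= len t.
        by rewrite leqNgt; apply/negP => lt; apply: H; exists y.
      by apply: string_eq; [lia|move=> i lt; apply: Eg; lia].
    apply: nl; exists t; split; first by rewrite -{2}(E z Zz).
    by move=> y /E; left.
  have ex : exists i, `[< exists y, Zof (snoc t i) y >].
    by exists (get s (len t)); apply/asboolP; exists s; split=> //; apply: extends_get.
  case: (ex_minnP ex) => i /asboolP Hi min; exists i; split=> //.
  move=> [m [[Zm em] lm]]; apply: nl; exists m.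
  have tm := extends_trans (extends_snoc t i) em.
  have vm : kbval m (len t) = i.+1.
    have /extendsP[] := em; rewrite len_snoc /kbval => -> /(_ _ (ltnSn _)) ->.
    by rewrite get_snoc ltnn.
  have agree y : extends t y -> forall j, j < len t -> kbval m j = kbval y j.
    move=> /extendsP[le1 E1] j lj; have /extendsP[le2 E2] := tm.
    by rewrite /kbval !(leq_trans lj) // E1 // E2.
  split=> // y [Zy ty]; case: (ltnP (len t) (len y)) => ly; last first.
    right; apply/kbltP; exists (len t); split; first exact: agree.
    by rewrite vm /kbval ltnNge ly.
  have ey := extends_get ty ly.
  case: (ltngtP (get y (len t)) i) => [lt|lt|E].
  - have := min (get y (len t)); rewrite leqNgt lt => H; suff: false by [].
    by apply: H; apply/asboolP; exists y.
  - right; apply/kbltP; exists (len t); split; first exact: agree.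
    by rewrite vm /kbval ly /vlt /= ltnS lt.
  - by apply: lm; rewrite -E.
have [nxt nxtP] : exists nxt : nat -> nat, forall t, good t -> good (snoc t (nxt t)).
  have H t : exists i, good t -> good (snoc t i).
    case: (EM (good t)) => [/goodS[i gi]|ng]; first by exists i.
    by exists 0.
  by have [nxt nP] := choice H; exists nxt.
pose s := fix s l := if l is l'.+1 then snoc (s l') (nxt (s l')) else 0.
have sE l : s l = pre (fun l => nxt (s l)) l by elim: l => //= l {1}->.
apply: nopath; exists (fun l => nxt (s l)) => l; rewrite -sE.
have [[z [Zz /andP[le /eqP <-]]] _] : good (s l) by elim: l => //= l /nxtP.
by apply: node_up; [lia|exact: Znode].
Qed.

Lemma lo_wfP e (R : rel nat) :
  (forall x y, phi e set0 (npair x y) (nat_of_bool (R x y))) ->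
  total R -> antisymmetric R -> transitive R ->
  lo_wf e <-> wochoice.well_order R.
Proof.
move=> eR Rt Ra Rtr; have [g [[gdom ginj gsur] gR]] := lo_complete eR Rt Ra Rtr.
have [_ [lanti _]] := lo_linear e; split=> H.
  apply: wochoice.antisymmetric_well_order => // B [b Bb].
  have [||z [[/asboolP[x [Bx ->]] zmin] _]] :=
      H (fun z => `[< exists x, x \in B /\ z = g x >]).
  - by move=> z /asboolP[x [_ ->]]; apply: gdom.
  - by exists (g b); apply/asboolP; exists b.
  exists x; split=> // y By; rewrite gR; apply: zmin.
  by apply/asboolP; exists y.
apply: wochoice.antisymmetric_wo_chain => // B sB [b Bb].
have [x Ex] : exists x, g x = b by have [x _ E] := gsur b (sB _ Bb); exists x.
have [|m [[Bm mmin] _]] := H (fun x => g x \in B).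
  by exists x; rewrite unfold_in Ex.
exists (g m); split=> // y By; have [z _ Ez] := gsur y (sB _ By).
by rewrite -Ez -gR; apply: mmin; rewrite unfold_in Ez.
Qed.

(** The Kleene-Brouwer order is spread over all natural numbers, so one index serves both for O and
    for the listing of linear orders. *)
Lemma kb_index (T : nat -> nat -> bool) :
  (forall A, decidable_in A (fun y => T (nfst y) (nsnd y))) ->
  exists t, (forall A, computable_in A t) /\ forall w,
    (t w \in kleeneO <-> ~ haspath (T w)) /\ (lo_wf (t w) <-> ~ haspath (T w)).
Proof.
move=> cT.
have cn A f g : computable_in A f -> computable_in A g ->
    decidable_in A (fun x => node (T (f x)) (g x)).
  move=> cf cg; apply: (@ci_comp2 A (fun w z => nat_of_bool (node (T w) z))) => //.
  rewrite /node; apply: di_ball; first by ci.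
  by apply: (@ci_comp2 A (fun w z => nat_of_bool (T w z))); auto with ci.
have ck A f g : computable_in A f -> computable_in A g ->
    decidable_in A (fun x => kblt (f x) (g x)).
  move=> cf cg; apply: (@ci_comp2 A (fun z w => nat_of_bool (kblt z w))) => //.
  rewrite /kblt; apply: di_neg; apply: (@di_ball A _ (fun y i => ~~ (ball i
   (fun j => kbval (nfst y) j == kbval (nsnd y) j) &&
     vlt (kbval (nfst y) i) (kbval (nsnd y) i)))); first by ci.
  rewrite /vlt /kbval; apply: di_neg; apply: di_and; last by ci.
  apply: (@di_ball A _ (fun y j => kbval (nfst (nfst y)) j == kbval (nsnd (nfst y)) j)).
    by ci.
  by rewrite /kbval; ci.
have [c cP] : decidable_in set0
    (fun u => kb (T (nfst u)) (nfst (nsnd u)) (nsnd (nsnd u))).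
  by rewrite /kb; auto 20 with ci.
have eR w x y : phi (smn c w) set0 (npair x y) (nat_of_bool (kb (T w) x y)).
  by apply/smnP; have := cP (npair w (npair x y)); rewrite !(nfstK, nsndK).
exists (smn c); split; first by move=> A; ci.
move=> w; have wo : wochoice.well_order (kb (T w)) <-> ~ haspath (T w).
  split; first by move=> H /haspath_not_wo.
  exact: nopath_wo.
split; last by rewrite (lo_wfP (eR w)) //; [exact: kb_total|exact: kb_anti|exact: kb_trans].
rewrite -wo in_setE; split=> [[R [RP]]|H]; last by exists (kb (T w)).
suff -> : R = kb (T w) by [].
apply/funext => x; apply/funext => y.
by have := evals_fun (RP x y) (eR w x y); case: (R x y); case: (kb _ _ _).
Qed.

(** * Paths, well-orderings and Kleene's O *)

Definition computable_family (T : nat -> nat -> bool) : Prop :=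
  forall A, decidable_in A (fun y => T (nfst y) (nsnd y)).

Lemma di_family T A f g : computable_family T -> computable_in A f ->
  computable_in A g -> decidable_in A (fun x => T (f x) (g x)).
Proof.
by move=> cT; apply: (@ci_comp2 A (fun w z => nat_of_bool (T w z))); apply: cT.
Qed.

Lemma di_haspath T f : computable_family T -> computable_in kleeneO f ->
  decidable_in kleeneO (fun x => `[< haspath (T (f x)) >]).
Proof.
move=> /kb_index[t [ct tP]] cf.
have c : decidable_in kleeneO (fun x => t (f x) \notin kleeneO).
  by apply: di_neg; apply: di_oracle; apply: ci_comp.
apply: ci_ext c _ => x; congr nat_of_bool; have [tO _] := tP (f x).
apply/negP/asboolP; last by move=> p /tO.
by move=> H; apply: contrapT => np; apply: H; apply/tO.
Qed.

(** This presents the paths through a given node as the paths of another computable tree, so that O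
    can decide whether there are any. *)
Lemma pathP (T : nat -> bool) z l : (exists2 f, forall l, T (pre f l) & pre f l = z) <->
  len z = l /\ haspath (fun y => T y && (extends z y || extends y z)).
Proof.
split=> [[f fT <-]|[El [f fP]]].
  split; first exact: len_pre.
  exists f => m; rewrite fT /=; case: (leqP l m) => [le|/ltnW le].
    by rewrite extends_pre.
  by rewrite (extends_pre f le) orbT.
exists f => [m|]; first by have /andP[] := fP m.
have /andP[_] := fP l; rewrite -El => H.
apply: string_eq; rewrite len_pre // => i lt; rewrite get_pre //.
by move: H => /orP[] /extendsP[_ H]; [rewrite -H ?get_pre // | rewrite H ?len_pre ?get_pre].
Qed.

Lemma leftmost_path T : computable_family T -> exists h, computable_in kleeneO h /\
  forall e, haspath (T e) -> exists2 f, (forall l, T e (pre f l)) &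
    forall n, h (npair e n) = f n.
Proof.
move=> cT.
pose T' w z := T (nfst w) z && (extends (nsnd w) z || extends z (nsnd w)).
have cT' : computable_family T'.
  by move=> A; rewrite /T'; apply: di_and; [apply: di_family|]; ci.
(* The implication keeps the search total at nodes that no path goes through. *)
pose P w i := `[< haspath (T' w) >] ==> `[< haspath (T' (npair (nfst w) (snoc (nsnd w) i))) >].
have cP : decidable_in kleeneO (fun y => P (nfst y) (nsnd y)).
  by apply: di_imp; apply: di_haspath => //; ci.
have ext e z : haspath (T' (npair e z)) -> exists i, haspath (T' (npair e (snoc z i))).
  rewrite /T' !(nfstK, nsndK) => H.
  have [f fT Ez] := (iffRL (pathP (T e) z (len z))) (conj erefl H).
  exists (f (len z)); have [_ H'] := (iffLR (pathP (T e) (pre f (len z).+1) (len z).+1))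
    (ex_intro2 _ _ f fT erefl).
  by move: H'; rewrite !(nfstK, nsndK) preS Ez.
have [|nxt [cnxt nxtP]] := ci_mu cP.
  move=> w; rewrite /P; case: asboolP => [H|]; last by exists 0.
  rewrite -(npairK w) in H; have [i Hi] := ext _ _ H.
  by exists i; apply/asboolP.
pose s e l := nrec 0 (fun _ z => snoc z (nxt (npair e z))) l.
have cs f g : computable_in kleeneO f -> computable_in kleeneO g ->
    computable_in kleeneO (fun x => s (f x) (g x)).
  move=> cf cg; apply: (@ci_comp2 _ s) => //.
  apply: (@ci_nrec _ (fun _ => 0) (fun y _ z => snoc z (nxt (npair (nfst y) z)))); try ci.
  by apply: ci_snoc; [ci|apply: ci_comp cnxt _; ci].
exists (fun x => nxt (npair (nfst x) (s (nfst x) (nsnd x)))); split.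
  by apply: ci_comp cnxt _; apply: ci_pair; auto with ci.
move=> e eP; pose f n := nxt (npair e (s e n)).
have sE l : s e l = pre f l by elim: l => // l IH; rewrite preS -IH.
exists f => [l|n]; last by rewrite nfstK nsndK.
have : haspath (T' (npair e (s e l))).
  elim: l => [|l IH].
    case: eP => g gT; exists g => m; rewrite /T' !(nfstK, nsndK) gT /=.
    by apply/orP; left; apply: (extends_pre g (leq0n m)).
  have [] := nxtP (npair e (s e l)); rewrite /P.
  by case: asboolP => //= _ /asboolP H _; move: H; rewrite nfstK nsndK.
rewrite sE /T' !(nfstK, nsndK) => H.
have [g gT <-] := (iffRL (pathP (T e) (pre f l) l)) (conj (len_pre _ _) H).
exact: gT.
Qed.

(** * Decidability of the listed linear orders, and trees of descending sequences *)

Section LinearOrders.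
Variable A : set nat.
Local Notation ci := (computable_in A).
Local Notation di := (decidable_in A).

Lemma di_lo_test e k x y b : ci e -> ci k -> ci x -> ci y -> ci b ->
  di (fun z => lo_test (e z) (k z) (x z) (y z) (b z)).
Proof.
move=> ce ck cx cy cb.
have c : di (fun z => evalo (k z) (fun _ => 1) (e z) (npair (x z) (y z)) == (b z).+1).
  apply: di_eq; last by ci.
  by apply: (@ci_evalo A (fun _ _ => 1) (fun _ => 0)); auto with ci.
apply: ci_ext c _ => z; congr nat_of_bool; rewrite /lo_test.
(* The empty oracle always answers 0, which is shifted to 1. *)
have -> : (fun _ : nat => 1) = oracle set0.
  by apply/funext => w; rewrite /oracle /char_fun in_set0.
by rewrite evalo_total; case: eval.
Qed.

Lemma forall_ball n (p : nat -> bool) : [forall u : 'I_n, p u] = ball n p.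
Proof.
apply/forallP/ballP => [H i lt|H i]; first exact: (H (Ordinal lt)).
exact: H.
Qed.

Lemma di_lo_approved e k x : ci e -> ci k -> ci x ->
  di (fun z => lo_approved (e z) (k z) (x z)).
Proof.
move=> ce ck cx; apply: (@ci_comp3 A (fun e k x => nat_of_bool (lo_approved e k x))) => //.
have c : di (fun y => let e := nfst y in let k := nfst (nsnd y) in
  let x := nsnd (nsnd y) in
  [&& ball x.+1 (fun u => ball x.+1 (fun v => lo_test e k u v 0 || lo_test e k u v 1)),
      ball x.+1 (fun u => ball x.+1 (fun v => lo_test e k u v 1 || lo_test e k v u 1)),
      ball x.+1 (fun u => ball x.+1 (fun v =>
        lo_test e k u v 1 && lo_test e k v u 1 ==> (u == v))) &
      ball x.+1 (fun u => ball x.+1 (fun v => ball x.+1 (fun w =>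
        lo_test e k u v 1 && lo_test e k v w 1 ==> lo_test e k u w 1)))]).
  cbv zeta; apply: di_and; [|apply: di_and; [|apply: di_and]].
  - apply: (@di_ball A _ (fun y u => _)); first by auto 10 with ci.
    apply: (@di_ball A _ (fun y v => _)); first by auto 10 with ci.
    by apply: di_or; apply: di_lo_test; auto 20 with ci.
  - apply: (@di_ball A _ (fun y u => _)); first by auto 10 with ci.
    apply: (@di_ball A _ (fun y v => _)); first by auto 10 with ci.
    by apply: di_or; apply: di_lo_test; auto 20 with ci.
  - apply: (@di_ball A _ (fun y u => _)); first by auto 10 with ci.
    apply: (@di_ball A _ (fun y v => _)); first by auto 10 with ci.
    apply: di_imp; last by auto 20 with ci.
    by apply: di_and; apply: di_lo_test; auto 20 with ci.
  - apply: (@di_ball A _ (fun y u => _)); first by auto 10 with ci.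
    apply: (@di_ball A _ (fun y v => _)); first by auto 10 with ci.
    apply: (@di_ball A _ (fun y v => _)); first by auto 10 with ci.
    apply: di_imp; last by apply: di_lo_test; auto 20 with ci.
    by apply: di_and; apply: di_lo_test; auto 20 with ci.
apply: ci_ext c _ => y; congr nat_of_bool; rewrite /lo_approved.
set e' := nfst y; set k' := nfst (nsnd y); set x' := nsnd (nsnd y).
cbv zeta; congr [&& _, _, _ & _]; rewrite -forall_ball; apply: eq_forallb => u;
  rewrite -forall_ball //; apply: eq_forallb => v; rewrite -?forall_ball //.
Qed.

Lemma di_lo_dom e z : ci e -> ci z -> di (fun x => lo_dom (e x) (z x)).
Proof.
move=> ce cz; apply: (@ci_comp2 A (fun e z => nat_of_bool (lo_dom e z))) => //.
have c : di (fun y => lo_approved (nfst y) (nsnd (nsnd y)) (nfst (nsnd y)) &&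
    ball (nsnd (nsnd y)) (fun j => ~~ lo_approved (nfst y) j (nfst (nsnd y)))).
  apply: di_and; first by apply: di_lo_approved; ci.
  apply: (@di_ball A _ (fun y j => _)); first by ci.
  by apply: di_neg; apply: di_lo_approved; ci.
by apply: ci_ext c _ => y; rewrite -forall_ball.
Qed.

Lemma di_lo_lt e z w : ci e -> ci z -> ci w -> di (fun x => lo_lt (e x) (z x) (w x)).
Proof.
move=> ce cz cw; rewrite /lo_lt /lo_le; apply: di_and; last by ci.
by apply: di_lo_test; auto with ci.
Qed.
End LinearOrders.
#[export] Hint Resolve di_lo_dom di_lo_lt di_lo_approved : ci.

Definition desc_tree (e z : nat) : bool :=
  ball (len z) (fun i => lo_dom e (get z i) &&
    ((i.+1 < len z) ==> lo_lt e (get z i.+1) (get z i))).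

Lemma computable_desc_tree : computable_family desc_tree.
Proof.
move=> A; apply: (@di_ball A _ (fun y i => _)); first by ci.
by ci.
Qed.

Lemma desc_treeP e f : (forall l, desc_tree e (pre f l)) <-> descending_in e f.
Proof.
split=> [H n|H l].
  have /ballP/(_ n) := H n.+2; rewrite len_pre => /(_ (ltnW (ltnSn _))).
  by rewrite !get_pre ?ltnSn //= => /andP[].
apply/ballP => i; rewrite len_pre => lt; have [H1 H2] := H i.
rewrite get_pre //; apply/andP; split=> //.
by apply/implyP => lt'; rewrite get_pre.
Qed.

Lemma lo_wf_desc e : lo_wf e <-> ~ exists s, descending_in e s.
Proof.
have [tot [anti trans]] := lo_linear e; split=> [wf [s sP]|nodesc].
  have [||m [[/asboolP[n ->] min] _]] := wf (fun z => `[< exists n, z = s n >]).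
  - by move=> z /asboolP[n ->]; have [] := sP n.
  - by exists (s 0); apply/asboolP; exists 0.
  have [Dn] := sP n; have [Dn1 _] := sP n.+1; move=> /andP[le /eqP ne].
  by apply: ne; apply: anti => //; rewrite le min //; apply/asboolP; exists n.+1.
apply: wochoice.antisymmetric_wo_chain => // B sB [b Bb].
apply: contrapT => nomin; apply: nodesc.
have nxt z : exists y, z \in B -> y \in B /\ lo_lt e y z.
  case: (boolP (z \in B)) => Bz; last by exists 0.
  apply: contrapT => H; apply: nomin; exists z; split=> // y By.
  have /orP[//|le] := tot z y (sB _ Bz) (sB _ By).
  case: (eqVneq y z) => [->|ne]; first by have := tot z z (sB _ Bz) (sB _ Bz); rewrite orbb.
  by case: H; exists y => _; split=> //; rewrite /lo_lt le.
have [f fP] := choice nxt; exists (fun n => iter n f b).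
have Bn n : iter n f b \in B by elim: n => //= n /fP[].
by move=> n; split; [exact: sB|have [] := fP _ (Bn n)].
Qed.

(* The paths of [nonO_tree e] witness that [e] is not in O: either the first  *)
(* entry is 0 and the others form a descending sequence of L_e, or the first  *)
(* entry is [x.+1] where [x] is never approved.                               *)
Definition nonO_tree (e z : nat) : bool :=
  if get z 0 == 0 then
    ball (len z) (fun i => (0 < i) ==> lo_dom e (get z i) &&
      ((i.+1 < len z) ==> lo_lt e (get z i.+1) (get z i)))
  else ball (len z) (fun k => ~~ lo_approved e k (get z 0).-1).

Lemma computable_nonO_tree : computable_family nonO_tree.
Proof.
move=> A; apply: di_ite; first by ci.
  by apply: (@di_ball A _ (fun y i => _)); ci.
by apply: (@di_ball A _ (fun y i => _)); ci.
Qed.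

Lemma nonO_nil e : nonO_tree e 0.
Proof. by rewrite /nonO_tree; case: (get 0 0 == 0). Qed.

Lemma lo_approved_leq e k x y : x <= y -> lo_approved e k y -> lo_approved e k x.
Proof.
move=> le /lo_approvedP[H1 H2 H3 H4]; apply/lo_approvedP.
by split; [move=> u v ux vx; apply: H1|move=> u v ux vx; apply: H2
  |move=> u v ux vx; apply: H3|move=> u v w ux vx wx; apply: H4];
  apply: leq_trans le.
Qed.

Lemma kleeneO_nonO e : e \in kleeneO <-> ~ haspath (nonO_tree e).
Proof.
rewrite in_setE; split=> [[R [RP wo]] [f fP]|nopath].
  have Rwo : wochoice.wo_chain R predT by move=> B _; apply: wo.
  have Rt : total R by move=> x y; apply: (wochoice.wo_chainW Rwo).
  have Ra : antisymmetric R by move=> x y; apply: (wochoice.wo_chain_antisymmetric Rwo).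
  have Rtr : transitive R.
    move=> y x z Rxy Ryz; have [|m [[Bm mmin] _]] := wo [pred u | u \in [:: x; y; z]].
      by exists x; rewrite !inE eqxx.
    have Rm u : u \in [:: x; y; z] -> R m u by move=> ?; apply: mmin.
    move: Bm; rewrite !inE => /or3P[] /eqP E; subst m.
    - by apply: Rm; rewrite !inE eqxx !orbT.
    - have Exy : x = y by apply: Ra; rewrite Rxy Rm // !inE eqxx.
      by rewrite Exy.
    - have Ezy : z = y by apply: Ra; rewrite Ryz Rm // !inE eqxx ?orbT.
      by rewrite Ezy.
  have wf : lo_wf e by apply/(lo_wfP RP Rt Ra Rtr).
  case: (posnP (f 0)) => f0.
    move/lo_wf_desc: wf; apply; exists (fun n => f n.+1); apply/desc_treeP => l.
    have := fP l.+1; rewrite /nonO_tree get_pre // f0 /= => /ballP H.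
    apply/ballP => i; rewrite len_pre => lt; have := H i.+1; rewrite len_pre => /(_ lt) /=.
    rewrite !ltnS; case: (ltnP i.+1 l) => lt' /=; rewrite !get_pre //=.
  have na k : ~~ lo_approved e k (f 0).-1.
    have := fP k.+1; rewrite /nonO_tree get_pre // -(prednK f0) /= => /ballP; apply.
    by rewrite len_pre.
  have [g [[gdom ginj _] _]] := lo_complete RP Rt Ra Rtr.
  have lt x : nfst (g x) < f 0.
    rewrite -(prednK f0) ltnS leqNgt; apply/negP => /ltnW le.
    have /andP[ap _] := gdom x I; have := lo_approved_leq le ap.
    by rewrite (negPf (na _)).
  (* Pigeonhole: if [(f 0).-1] is never approved, L_e has at most [f 0] elements, yet it is a copy
     of an order of all natural numbers. *)
  pose G (i : 'I_(f 0).+1) : 'I_(f 0) := Ordinal (lt i).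
  have : injective G.
    move=> i j [E]; apply/val_inj/ginj; rewrite ?inE //.
    exact: lo_dom_inj (gdom _ I) (gdom _ I) E.
  by move/leq_card; rewrite !card_ord ltnn.
have ap x : exists k, lo_approved e k x.
  apply: contrapT => H; apply: nopath; exists (fun _ => x.+1) => l.
  case: l => [|l]; first exact: nonO_nil.
  rewrite /nonO_tree.
  rewrite get_pre //=; apply/ballP => k _; apply/negP => ak; apply: H.
  by exists k.
have wf : lo_wf e.
  apply/lo_wf_desc => -[s sP]; apply: nopath; exists (fun n => if n is m.+1 then s m else 0).
  move=> [|l]; first exact: nonO_nil.
  rewrite /nonO_tree.
  rewrite get_pre //=; apply/ballP => -[//|i]; rewrite len_pre => lt /=.
  rewrite get_pre // ; have [Ds sl] := sP i; rewrite (Ds : lo_dom e (s i)).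
  by apply/implyP => lt'; rewrite get_pre.
pose R x y := `[< phi e set0 (npair x y) 1 >].
have test k u v : lo_test e k u v 1 -> R u v.
  by move=> /eqP t; apply/asboolP; exists k.
have apR k x u v : lo_approved e k x -> u <= x -> v <= x -> lo_test e k u v (R u v).
  move=> /lo_approvedP[H _ _ _] ux vx; have := H u v ux vx.
  case Ruv: (R u v); last by case/orP => // /test; rewrite Ruv.
  case/orP => // t0; move/asboolP: Ruv => -[l /eqP t1].
  by have := lo_test_fun t0 t1.
have RP x y : phi e set0 (npair x y) (nat_of_bool (R x y)).
  have [k ak] := ap (maxn x y); exists k; apply/eqP.
  exact: apR ak (leq_maxl _ _) (leq_maxr _ _).
have testE k x u v : lo_approved e k x -> u <= x -> v <= x -> R u v -> lo_test e k u v 1.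
  by move=> ak ux vx Ruv; have := apR _ _ _ _ ak ux vx; rewrite Ruv.
have Rt : total R.
  move=> x y; have [k ak] := ap (maxn x y).
  have /lo_approvedP[_ H _ _] := ak.
  by have /orP[/test->|/test->] := H x y (leq_maxl _ _) (leq_maxr _ _); rewrite ?orbT.
have Ra : antisymmetric R.
  move=> x y /andP[Rxy Ryx]; have [k ak] := ap (maxn x y).
  have /lo_approvedP[_ _ H _] := ak; have [lx ly] := (leq_maxl x y, leq_maxr x y).
  by apply: H (testE _ _ _ _ ak lx ly Rxy) (testE _ _ _ _ ak ly lx Ryx).
have Rtr : transitive R.
  move=> y x z Rxy Ryz; have [k ak] := ap (maxn x (maxn y z)).
  have /lo_approvedP[_ _ _ H] := ak.
  have lx := leq_maxl x (maxn y z).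
  have ly := leq_trans (leq_maxl y z) (leq_maxr x (maxn y z)).
  have lz := leq_trans (leq_maxr y z) (leq_maxr x (maxn y z)).
  exact: test (H _ _ _ lx ly lz (testE _ _ _ _ ak lx ly Rxy) (testE _ _ _ _ ak ly lz Ryz)).
by exists R; split=> //; apply/(lo_wfP RP Rt Ra Rtr).
Qed.

(** Membership in O also demands that [e] is total and linear; [nonO_tree] absorbs these demands
    into the well-foundedness of another listed order. *)
Lemma kleeneO_lo_wf : exists t, (forall A, computable_in A t) /\
  forall e, e \in kleeneO <-> lo_wf (t e).
Proof.
have [t [ct tP]] := kb_index computable_nonO_tree; exists t; split=> // e.
by have [_ ->] := tP e; apply: kleeneO_nonO.
Qed.

(** * Forcing with strings and classes of lower bounds *)

Definition graph (g : nat -> nat) : set nat := [set z | nsnd z = g (nfst z)]%classic.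

(* The finite part of the graph of a function that is known from the string   *)
(* [q], as a partial oracle.                                                  *)
Definition string_oracle (q z : nat) : nat :=
  if nfst z < len q then (nat_of_bool (get q (nfst z) == nsnd z)).+1 else 0.

(* The sentence [sentence c n b] says that [c] halts on [n], with value [v]   *)
(* if [b = v.+1].                                                             *)
Definition sentence (c n b : nat) : nat := npair c (npair n b).

(** The length of [q] is both the extent of the oracle and the fuel; this makes truth decidable and
    preserved by extension. *)
Definition holds (s q : nat) : bool :=
  let r := evalo (len q) (string_oracle q) (nfst s) (nfst (nsnd s)) in
  (0 < r) && ((nsnd (nsnd s) == 0) || (nsnd (nsnd s) == r)).

Lemma di_holds A f g : computable_in A f -> computable_in A g ->
  decidable_in A (fun x => holds (f x) (g x)).
Proof.
move=> cf cg; apply: (@ci_comp2 A (fun s q => nat_of_bool (holds s q))) => //.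
rewrite /holds.
have c : computable_in A (fun y => evalo (len (nsnd y)) (string_oracle (nsnd y))
    (nfst (nfst y)) (nfst (nsnd (nfst y)))).
  by apply: (@ci_evalo A string_oracle nsnd); rewrite /string_oracle; ci.
by cbv zeta; auto 20 with ci.
Qed.
#[export] Hint Resolve di_holds : ci.

Lemma string_oracle_extends p q z : extends p q -> 0 < string_oracle p z ->
  string_oracle q z = string_oracle p z.
Proof.
move=> /extendsP[le E]; rewrite /string_oracle; case: ifP => // lt _.
by rewrite (leq_trans lt le) E.
Qed.

Lemma holds_extends s p q : extends p q -> holds s p -> holds s q.
Proof.
move=> pq; rewrite /holds /evalo; case E: evalp => [m|//].
rewrite (evalp_leq _ _ E) //; first by have /extendsP[] := pq.
by move=> z; apply: string_oracle_extends.
Qed.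

Lemma holds_pre g c n b : (exists l, holds (sentence c n b) (pre g l)) <->
  exists m, phi c (graph g) n m /\ (b = 0 \/ b = m.+1).
Proof.
have agree l z : 0 < string_oracle (pre g l) z ->
    oracle (graph g) z = string_oracle (pre g l) z.
  rewrite /string_oracle len_pre; case: ifP => // lt _.
  rewrite get_pre // /oracle /char_fun; congr (nat_of_bool _).+1.
  by apply/idP/eqP; rewrite in_setE; apply: esym.
rewrite /holds /sentence !(nfstK, nsndK); split=> [[l]|[m [[k Ek] Eb]]].
  rewrite /evalo; case E: evalp => [m|//] /= Hb; exists m; split.
    exists (len (pre g l)); rewrite -evalp_total.
    by apply: evalp_leq E => // z; apply: agree.
  by case/orP: Hb => /eqP ->; [left|right].
rewrite -evalp_total in Ek.
have [||l El] := @evalp_compact (fun l => string_oracle (pre g l)) _ _ _ _ _ _ _ Ek.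
- by move=> l l' z le; apply: string_oracle_extends; apply: extends_pre.
- move=> z _; exists (nfst z).+1; apply/esym/agree.
  by rewrite /string_oracle len_pre ltnSn.
exists (maxn k l); rewrite /evalo len_pre (evalp_leq _ _ El) ?leq_maxl //=.
  by case: Eb => ->; rewrite eqxx ?orbT.
by move=> z; apply: string_oracle_extends; apply: extends_pre; apply: leq_maxr.
Qed.

(* A condition [npair p W] consists of a string [p] and a list [W] of pairs   *)
(* [npair p' s] of a string and a sentence.  It has to be compatible with     *)
(* some lower bound [u] such that no extension of [p'] above [u] makes [s]    *)
(* hold, for all these pairs.                                                 *)
Definition above (q : nat) (u : nat -> nat) : Prop :=
  forall i, i < len q -> u i <= get q i.

Definition bounds (w : nat) (u : nat -> nat) : Prop :=
  above (nfst w) u /\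
  forall j, j < len (nsnd w) -> forall q, extends (nfst (get (nsnd w) j)) q ->
    above q u -> ~~ holds (nsnd (get (nsnd w) j)) q.

Definition above_str (q z : nat) : bool :=
  ball (len z) (fun i => (i < len q) ==> (get z i <= get q i)).

(** Only strings [q] with code at most [len z] are tested. They are no longer than [z], so
    [above_str] compares all their entries. *)
Definition cond_tree (w z : nat) : bool :=
  above_str (nfst w) z &&
  ball (len (nsnd w)) (fun j => ball (len z).+1 (fun q =>
    extends (nfst (get (nsnd w) j)) q && above_str q z ==>
    ~~ holds (nsnd (get (nsnd w) j)) q)).

Lemma computable_cond_tree : computable_family cond_tree.
Proof.
have ca A f g : computable_in A f -> computable_in A g ->
    decidable_in A (fun x => above_str (f x) (g x)).
  move=> cf cg; apply: (@ci_comp2 A (fun q z => nat_of_bool (above_str q z))) => //.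
  by apply: (@di_ball A _ (fun y i => _)); ci.
move=> A; apply: di_and; first by ci.
apply: (@di_ball A _ (fun y j => _)); first by ci.
apply: (@di_ball A _ (fun y q => _)); first by ci.
by auto 20 with ci.
Qed.

Lemma above_strP q u : (forall l, above_str q (pre u l)) <-> above q u.
Proof.
split=> [H i lt|H l].
  have /ballP/(_ i) := H i.+1; rewrite len_pre ltnSn => /(_ isT).
  by rewrite lt get_pre.
apply/ballP => i; rewrite len_pre => lt; apply/implyP => lt'.
by rewrite get_pre //; apply: H.
Qed.

Lemma cond_treeP w u : (forall l, cond_tree w (pre u l)) <-> bounds w u.
Proof.
split=> [H|[H1 H2] l].
  split; first by apply/above_strP => l; have /andP[] := H l.
  move=> j lt q eq au; have /andP[_ /ballP/(_ _ lt)/ballP/(_ q)] := H q.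
  rewrite len_pre ltnSn eq => /(_ isT) /implyP; apply.
  exact: (iffRL (above_strP _ _) au).
apply/andP; split; first exact: (iffRL (above_strP _ _) H1).
apply/ballP => j lt; apply/ballP => q; rewrite len_pre ltnS => le.
apply/implyP => /andP[eq /ballP au]; apply: H2 => // i li.
have li' := leq_trans (leq_trans li (len_leq q)) le.
by have := au i; rewrite len_pre li' li get_pre // => /(_ isT).
Qed.

Definition cond (w : nat) : Prop := exists u, bounds w u.

Lemma condP w : haspath (cond_tree w) <-> cond w.
Proof. by split=> -[u uP]; exists u; apply/cond_treeP. Qed.

Lemma di_cond f : computable_in kleeneO f ->
  decidable_in kleeneO (fun x => `[< cond (f x) >]).
Proof.
move=> cf; apply: ci_ext (di_haspath computable_cond_tree cf) _ => x.
by congr nat_of_bool; apply/asboolP/asboolP => /condP.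
Qed.

(** Raising a bound leaves fewer strings above it, so restraints persist. Both the domination of [h]
    and the merging of two restraints depend on this. *)
Lemma bounds_up w u v : bounds w u -> above (nfst w) v -> (forall i, u i <= v i) ->
  bounds w v.
Proof.
move=> [_ H] av uv; split=> // j lt q eq aq; apply: H => // i li.
exact: leq_trans (uv i) (aq i li).
Qed.

Definition exclude (w s : nat) : nat :=
  npair (nfst w) (snoc (nsnd w) (npair (nfst w) s)).

Lemma bounds_exclude w s u : bounds (exclude w s) u <->
  bounds w u /\ forall q, extends (nfst w) q -> above q u -> ~~ holds s q.
Proof.
rewrite /bounds /exclude !(nfstK, nsndK) len_snoc; split=> [[H1 H2]|[[H1 H2] H3]].
  split; first split=> //.
    by move=> j lt; have := H2 j; rewrite get_snoc lt ltnS (ltnW lt); apply.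
  by have := H2 (len (nsnd w)) (ltnSn _); rewrite get_snoc ltnn nfstK nsndK.
split=> // j; rewrite ltnS get_snoc => le; case: ltnP => lt; first exact: H2.
by rewrite nfstK nsndK.
Qed.

Definition stretch (p : nat) (u : nat -> nat) (l : nat) : nat :=
  pre (fun i => if i < len p then get p i else u i) l.

Lemma stretch_extends p u l : len p <= l -> extends p (stretch p u l).
Proof.
move=> le; apply/extendsP; rewrite len_pre; split=> // i lt.
by rewrite get_pre ?lt //; apply: leq_trans lt le.
Qed.

Lemma stretch_above p u l : above p u -> above (stretch p u l) u.
Proof.
move=> ap i; rewrite len_pre => lt; rewrite get_pre //.
by case: ifP => // /ap.
Qed.

(** * The generic function and its jump *)

Section Construction.
Variables h : nat -> nat.
Hypothesis ch : computable_in kleeneO h.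

Definition stronger (w' w : nat) : Prop :=
  [/\ cond w', extends (nfst w) (nfst w'), extends (nsnd w) (nsnd w') &
      forall i, len (nfst w) <= i < len (nfst w') -> h i <= get (nfst w') i].

Lemma stronger_refl w : cond w -> stronger w w.
Proof.
by split=> //; [exact: extends_refl|exact: extends_refl|move=> i; lia].
Qed.

Lemma stronger_trans w1 w2 w3 : stronger w3 w2 -> stronger w2 w1 -> stronger w3 w1.
Proof.
move=> [c3 p3 W3 h3] [c2 p2 W2 h2]; split=> //.
- exact: extends_trans p3.
- exact: extends_trans W3.
move=> i /andP[l1 l2]; case: (leqP (len (nfst w2)) i) => lt; first exact/h3/andP.
have /extendsP[_ ->] // := p3; exact/h2/andP.
Qed.

Definition witness (w s q : nat) : bool :=
  [&& extends (nfst w) q, len (nfst w) < len q, holds s q,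
      ball (len q) (fun i => (len (nfst w) <= i) ==> (h i <= get q i)) &
      `[< cond (npair q (nsnd w)) >]].

Lemma witness_exists w s : cond w -> ~ cond (exclude w s) -> exists q, witness w s q.
Proof.
move=> [u uP] nex.
(* Raising the bound to [h] past the current string makes every extension above it dominate [h]
   there. *)
pose v i := if i < len (nfst w) then u i else maxn (u i) (h i).
have vP : bounds w v.
  apply: (bounds_up uP) => [i lt|i]; first by rewrite /v lt; have [->] := uP.
  by rewrite /v; case: ifP => // _; apply: leq_maxl.
have [q [pq av hq]] : exists q, [/\ extends (nfst w) q, above q v & holds s q].
  apply: contrapT => H; apply: nex; exists v; apply/bounds_exclude; split=> // q pq av.
  by apply/negP => hq; apply: H; exists q.
(* One more entry than [q] ensures proper growth even if [q] is the current string. *)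
pose r := stretch q v (len q).+1.
have qr : extends q r by exact: stretch_extends.
have ar : above r v by exact: stretch_above.
exists r; apply/and5P; split.
- exact: extends_trans qr.
- by rewrite len_pre ltnS; have /extendsP[] := pq.
- exact: holds_extends hq.
- apply/ballP => i lt; apply/implyP => le; apply: leq_trans (ar i lt).
  by rewrite /v ltnNge le /= leq_maxr.
- apply/asboolP; exists v; have [_ vW] := vP.
  by rewrite /bounds nfstK nsndK.
Qed.

Lemma di_witness : decidable_in kleeneO
  (fun y => witness (nfst (nfst y)) (nsnd (nfst y)) (nsnd y)).
Proof.
have chh f : computable_in kleeneO f -> computable_in kleeneO (fun x => h (f x)).
  exact: ci_comp.
rewrite /witness; apply: di_and; first by ci.
apply: di_and; first by ci.
apply: di_and; first by ci.
apply: di_and; last by apply: di_cond; ci.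
by apply: (@di_ball _ _ (fun y i => _)); auto 20 with ci.
Qed.

(** The first two alternatives make the search for [q] total when no witness is wanted. *)
Definition positive (x q : nat) : bool :=
  [|| ~~ `[< cond (nfst x) >], `[< cond (exclude (nfst x) (nsnd x)) >] |
      witness (nfst x) (nsnd x) q].

Lemma force_exists : exists force : nat -> nat -> nat,
  computable_in kleeneO (fun x => force (nfst x) (nsnd x)) /\
  forall w s, cond w ->
    (cond (exclude w s) -> force w s = exclude w s) /\
    (~ cond (exclude w s) -> exists2 q, witness w s q & force w s = npair q (nsnd w)).
Proof.
have ce f g : computable_in kleeneO f -> computable_in kleeneO g ->
  computable_in kleeneO (fun x => exclude (f x) (g x)) by rewrite /exclude; ci.
have [||find [cfind findP]] := @ci_mu kleeneO positive.
- rewrite /positive; apply: di_or; first by apply/di_neg/di_cond; ci.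
  apply: di_or; first by apply: di_cond; ci.
  exact: di_witness.
- move=> x; case: (EM (cond (nfst x))) => cw; last first.
    by exists 0; rewrite /positive asboolF.
  case: (EM (cond (exclude (nfst x) (nsnd x)))) => ce'.
    by exists 0; rewrite /positive (asboolT ce') orbT.
  by have [q wq] := witness_exists cw ce'; exists q; rewrite /positive wq !orbT.
exists (fun w s => if `[< cond (exclude w s) >] then exclude w s
  else npair (find (npair w s)) (nsnd w)).
split.
  apply: di_if; first by apply: di_cond; ci.
    by ci.
  by apply: ci_pair; [apply: ci_comp cfind _; ci|ci].
move=> w s cw; split=> H; first by rewrite asboolT.
exists (find (npair w s)); last by rewrite asboolF.
have [+ _] := findP (npair w s); rewrite /positive nfstK nsndK (asboolT cw) asboolF //.
Qed.

Variable force : nat -> nat -> nat.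
Hypothesis cforce : computable_in kleeneO (fun x => force (nfst x) (nsnd x)).
Hypothesis forceP : forall w s, cond w ->
    (cond (exclude w s) -> force w s = exclude w s) /\
    (~ cond (exclude w s) -> exists2 q, witness w s q & force w s = npair q (nsnd w)).

Lemma force_stronger w s : cond w -> stronger (force w s) w.
Proof.
move=> cw; have [F1 F2] := forceP s cw.
case: (EM (cond (exclude w s))) => [/[dup] ce /F1 -> | /F2 [q /and5P[pq lq hq]]].
  split=> //; rewrite /exclude ?nfstK ?nsndK; first exact: extends_refl.
    exact: extends_snoc.
  by move=> i; lia.
move=> /ballP hb /asboolP cq ->; split; rewrite ?nfstK ?nsndK //.
  exact: extends_refl.
by move=> i /andP[l1 l2]; have := hb i l2; rewrite l1.
Qed.

Variable M : nat -> bool.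
Hypothesis cM : decidable_in kleeneO M.

(* The stage [s] decides whether [s] belongs to the jump, and diagonalizes    *)
(* against the function computed by [s], at the argument [diag w s].  The     *)
(* values are shifted by 1, as in [sentence]: 1 is tried first if [M], and 0  *)
(* otherwise.  The last step makes the string longer, as its sentence is true *)
(* but excluded by no bound.                                                  *)
Definition decided (w s : nat) : nat := force w (sentence s s 0).
Definition diag (w s : nat) : nat := npair (decided w s) s.
Definition first_value (w s : nat) : nat := if M (diag w s) then 2 else 1.
Definition diag1 (w s : nat) : nat :=
  force (decided w s) (sentence s (diag w s) (first_value w s)).
Definition diag2 (w s : nat) : nat := force (diag1 w s) (sentence s (diag w s) 1).
Definition stage (w s : nat) : nat := force (diag2 w s) (sentence 0 0 0).

Definition state (s : nat) : nat := nrec (npair 0 0) (fun i w => stage w i) s.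

Lemma ci_state : computable_in kleeneO state.
Proof.
have cf f g : computable_in kleeneO f -> computable_in kleeneO g ->
  computable_in kleeneO (fun x => force (f x) (g x)) by apply: ci_comp2.
have cMM f : computable_in kleeneO f -> decidable_in kleeneO (fun x => M (f x)).
  exact: (@ci_comp _ (fun n => nat_of_bool (M n))) cM.
apply: (@ci_nrec _ (fun _ => npair 0 0) (fun _ i w => stage w i)); try ci.
rewrite /stage /diag2 /diag1 /first_value /diag /decided /sentence.
by auto 40 with ci.
Qed.

Lemma cond_init : cond (npair 0 0).
Proof.
by exists (fun _ => 0); split; rewrite ?nfstK ?nsndK.
Qed.

Lemma stage_stronger w s : cond w ->
  [/\ stronger (decided w s) w, stronger (diag1 w s) (decided w s),
      stronger (diag2 w s) (diag1 w s) & stronger (stage w s) (diag2 w s)].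
Proof.
move=> cw; have s1 := force_stronger (sentence s s 0) cw.
have [c1 _ _ _] := s1.
have s2 := force_stronger (sentence s (diag w s) (first_value w s)) c1.
have [c2 _ _ _] := s2.
have s3 := force_stronger (sentence s (diag w s) 1) c2.
have [c3 _ _ _] := s3.
by split=> //; apply: force_stronger.
Qed.

Lemma cond_state s : cond (state s).
Proof.
elim: s => [|s IH]; first exact: cond_init.
by have [_ _ _ []] := stage_stronger s IH.
Qed.

Lemma state_stronger s t : s <= t -> stronger (state t) (state s).
Proof.
move=> /subnK <-; elim: (t - s) => [|d IH].
  by apply: stronger_refl; apply: cond_state.
apply: stronger_trans IH; rewrite addSn.
have [s1 s2 s3 s4] := stage_stronger (d + s) (cond_state (d + s)).
exact: stronger_trans (stronger_trans s4 s3) (stronger_trans s2 s1).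
Qed.

(** Program 0 is [CZero], which halts as soon as there is fuel, that is, on every nonempty string.
    Its sentence cannot be excluded, so [force] moves to a witness, which is longer. *)
Lemma stage_longer w s : cond w -> len (nfst (diag2 w s)) < len (nfst (stage w s)).
Proof.
move=> cw; have [_ _ [c2 _ _ _] _] := stage_stronger s cw.
have [_ []] := forceP (sentence 0 0 0) c2.
  move=> [u /bounds_exclude[[ap _] H]]; set p := nfst _ in ap H.
  have := H (stretch p u (len p).+1) (stretch_extends _ (leqnSn _)) (@stretch_above p u _ ap).
  by rewrite /holds /sentence !(nfstK, nsndK) len_pre /evalo.
by move=> q /and5P[_ lt _ _ _]; rewrite /stage => ->; rewrite nfstK.
Qed.

Lemma len_state s : s <= len (nfst (state s)).
Proof.
elim: s => // s IH; apply: leq_ltn_trans IH _.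
apply: leq_ltn_trans (stage_longer s (cond_state s)).
have [[_ /extendsP[l1 _] _ _] [_ /extendsP[l2 _] _ _] [_ /extendsP[l3 _] _ _] _] :=
  stage_stronger s (cond_state s).
exact: leq_trans l1 (leq_trans l2 l3).
Qed.

Definition generic (i : nat) : nat := get (nfst (state i.+1)) i.

Lemma pre_generic s : pre generic (len (nfst (state s))) = nfst (state s).
Proof.
apply: string_eq; rewrite len_pre // => i lt; rewrite get_pre // /generic.
have [_ /extendsP[_ E1] _ _] := state_stronger (leq_maxl s i.+1).
have [_ /extendsP[_ E2] _ _] := state_stronger (leq_maxr s i.+1).
by rewrite -E1 // E2 //; apply: len_state.
Qed.

Lemma generic_bound i : h i <= generic i.
Proof.
have [_ _ _] := state_stronger (leq0n i.+1); apply.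
have -> : nfst (state 0) = 0 by exact: nfstK.
by rewrite len0 /=; apply: len_state.
Qed.

(** If [s] is excluded, all later conditions retain the restraint. Their strings extend any given
    initial segment of [generic] and lie above their own bounds, so [s] never becomes true.
    Otherwise [force] has taken a string that makes [s] true. *)
Lemma force_decides w s t : cond w -> stronger (state t) (force w s) ->
  (cond (exclude w s) -> forall l, ~~ holds s (pre generic l)) /\
  (~ cond (exclude w s) -> exists l, holds s (pre generic l)).
Proof.
move=> cw [_ p1 W1 _]; have [F1 F2] := forceP s cw; split=> [ce l|/F2[q]].
  move: p1 W1; rewrite F1 // /exclude nfstK nsndK => p1 W1; apply/negP => hl.
  have [[u [au uW]] p2 W2 _] := state_stronger (leq_maxl t l).
  have /extendsP[] := extends_trans W1 W2; rewrite len_snoc => lW /(_ _ (ltnSn _)) EW.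
  have := uW _ lW; rewrite EW get_snoc ltnn nfstK nsndK => /(_ (nfst (state (maxn t l)))).
  move=> /(_ (extends_trans p1 p2) au) /negP; apply.
  rewrite -pre_generic; apply: holds_extends hl; apply: extends_pre.
  exact: leq_trans (leq_maxr t l) (len_state _).
move=> /and5P[_ _ hq _ _] E; exists (len (nfst (state t))); rewrite pre_generic.
by apply: holds_extends hq; move: p1; rewrite E nfstK.
Qed.

Lemma decided_stronger s : stronger (state s.+1) (decided (state s) s).
Proof.
have [_ s2 s3 s4] := stage_stronger s (cond_state s).
exact: stronger_trans (stronger_trans s4 s3) s2.
Qed.

Lemma jump_generic : turing_le (jump (graph generic)) kleeneO.
Proof.
apply/turing_leP.
have c : decidable_in kleeneO (fun s => ~~ `[< cond (exclude (state s) (sentence s s 0)) >]).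
  apply: di_neg; apply: di_cond; rewrite /exclude /sentence.
  have cs := ci_state; by ci.
apply: ci_ext c _ => s; congr nat_of_bool; rewrite -asbool_neg.
have [H1 H2] := force_decides (cond_state s) (decided_stronger s).
apply/asboolP/idP => [/H2 /holds_pre [m [Hm _]]|].
  by rewrite in_setE; exists m.
rewrite in_setE => -[m Hm] /H1 H.
have /holds_pre[l] : exists m, phi s (graph generic) s m /\ (0 = 0 \/ 0 = m.+1).
  by exists m; split; [|left].
by rewrite (negPf (H l)).
Qed.

(** The argument [n] codes the condition and the program, so that the trees attached to [n] are
    computable from [n] without knowledge of the construction. *)
Definition value_excluded (n j : nat) : Prop :=
  cond (exclude (nfst n) (sentence (nsnd n) n j.+1)).

Lemma diagonalize c : exists n,
  [/\ nsnd n = c, 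
      (~~ M n -> ~ value_excluded n 0 -> phi c (graph generic) n 0),
      (M n -> ~ value_excluded n 1 -> phi c (graph generic) n 1) &
      (M n -> value_excluded n 0 -> value_excluded n 1 ->
        ~ phi c (graph generic) n 0 /\ ~ phi c (graph generic) n 1)].
Proof.
pose w := decided (state c) c; pose n := diag (state c) c.
have [[cw _ _ _] s2 s3 s4] := stage_stronger c (cond_state c).
have d1 := @force_decides _ (sentence c n (first_value (state c) c)) c.+1 cw
  (stronger_trans s4 s3).
have [c1 _ _ _] := s2.
have d2 := @force_decides _ (sentence c n 1) c.+1 c1 s4.
have holdsE j : (exists l, holds (sentence c n j.+1) (pre generic l)) <->
    phi c (graph generic) n j.
  rewrite holds_pre; split=> [[m [Hm [//|[->]]]]//|H].
  by exists j; split=> //; right.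
have vE j : value_excluded n j = cond (exclude w (sentence c n j.+1)).
  by rewrite /value_excluded /n /diag nfstK nsndK.
have fE : first_value (state c) c = if M n then 2 else 1 by [].
exists n; rewrite !vE; split; first by rewrite /n /diag nsndK.
- move=> Mn nv; apply/holdsE; move: d1 => [_]; rewrite fE (negPf Mn).
  by apply.
- move=> Mn nv; apply/holdsE; move: d1 => [_]; rewrite fE Mn.
  by apply.
move=> Mn [u0 u0P] [u1 u1P]; split.
  move/holdsE=> [l]; apply/negP; move: d2 => [+ _]; apply.
  have [F1 _] := forceP (sentence c n 2) cw.
  rewrite /diag1 fE Mn F1; last by exists u1.
  have /bounds_exclude[b0 e0] := u0P; have /bounds_exclude[b1 e1] := u1P.
  (* The maximum of the two bounds respects both restraints, so value 0 can still be excluded after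
     value 1. *)
  exists (fun i => maxn (u0 i) (u1 i)); apply/bounds_exclude; split; last first.
    move=> q; rewrite /exclude nfstK => pq aq; apply: e0 => // i lt.
    exact: leq_trans (leq_maxl _ _) (aq i lt).
  have am : above (nfst w) (fun i => maxn (u0 i) (u1 i)).
    move=> i lt; rewrite geq_max; have [a0 _] := b0; have [a1 _] := b1.
    by rewrite a0 // a1.
  apply: (bounds_up u1P); first by rewrite /exclude nfstK.
  by move=> i; apply: leq_maxr.
move/holdsE=> [l]; apply/negP; move: d1 => [+ _]; rewrite fE Mn; apply.
by exists u1.
Qed.

End Construction.

(** * Comparison of trees *)

Lemma eq_nrec b s s' n : (forall i, i < n -> s i =1 s' i) -> nrec b s n = nrec b s' n.
Proof.
elim: n => [//|n IH] E /=; rewrite IH => [|i lt]; first exact: E.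
by apply: E; lia.
Qed.

Definition closed_tree (T : nat -> bool) : Prop := forall x, T x -> T (parent x).

Lemma closed_up (T : nat -> bool) i x : closed_tree T -> T x -> T (up i x).
Proof. by move=> cT Tx; elim: i => //= i /cT. Qed.

Lemma closed_extends (T : nat -> bool) x y : closed_tree T -> extends x y -> T y -> T x.
Proof. by move=> cT /andP[_ /eqP <-]; apply: closed_up. Qed.

Lemma sequence_path (T : nat -> bool) (s : nat -> nat) : s 0 = 0 ->
  (forall n, 0 < s n.+1 /\ parent (s n.+1) = s n) -> (forall n, T (s n)) ->
  haspath T.
Proof.
move=> s0 sS Ts; exists (fun n => top (s n.+1)) => l.
suff -> : pre (fun n => top (s n.+1)) l = s l by [].
elim: l => [//|l IH]; rewrite preS IH; have [p <-] := sS l; exact: snocK.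
Qed.

Lemma extends_len_eq x y : extends x y -> len x = len y -> x = y.
Proof. by move=> /extendsP[_ H] E; apply: string_eq => // i lt; rewrite H. Qed.

Lemma extends_parent x y : extends x y -> len x < len y -> extends x (parent y).
Proof.
move=> /andP[le /eqP E] lt; have y0 : 0 < y by rewrite lt0n -len_eq0; lia.
rewrite /extends; have Ey := len_parent y0; apply/andP; split; first by lia.
by apply/eqP; rewrite -{2}E -upS; congr up; lia.
Qed.

(** For well-founded trees with a root, such a map exists with [d = 0] if the rank of [S] is at most
    that of [T], and with [d = 1] if it is smaller. *)
Definition tree_map (d : nat) (S T : nat -> bool) (F : nat -> nat) : Prop :=
  forall x, S x -> [/\ T (F x), len (F x) = len x + d &
    0 < x -> parent (F x) = F (parent x)].

Lemma tree_map_path d (S T : nat -> bool) : haspath T -> exists F, tree_map d S T F.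
Proof.
move=> [f fT]; exists (fun x => pre f (len x + d)) => x _.
rewrite len_pre; split=> // x0; rewrite -[LHS]/(up 1 _) up_pre; congr pre.
by rewrite (len_parent x0); lia.
Qed.

(** Iterating [F \o G] from the root climbs one level each time. Compatibility with parents makes
    the iterates a path of [S] and their images under [G] a path of [T]. *)
Lemma tree_maps_paths (S T : nat -> bool) F G : S 0 -> T 0 ->
  tree_map 0 T S F -> tree_map 1 S T G -> haspath S /\ haspath T.
Proof.
move=> S0 T0 FP GP; pose s n := iter n (F \o G) 0.
have Ss n : S (s n).
  by elim: n => //= n IH; have [TG _ _] := GP _ IH; have [] := FP _ TG.
have TG n : T (G (s n)) by have [] := GP _ (Ss n).
have lG n : len (G (s n)) = (len (s n)).+1 by have [_ -> _] := GP _ (Ss n); rewrite addn1.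
have G0 n : 0 < G (s n) by rewrite lt0n -len_eq0 lG.
have sS n : s n.+1 = F (G (s n)) by [].
have ls n : len (s n) = n.
  by elim: n => // n IH; rewrite sS; have [_ -> _] := FP _ (TG n); rewrite addn0 lG IH.
have s0 n : 0 < s n.+1 by rewrite lt0n -len_eq0 ls.
have ps n : parent (s n.+1) = s n.
  elim: n => [|n IH]; first by apply/eqP; rewrite -len_eq0 -[parent _]/(up 1 _) len_up ls.
  rewrite sS; have [_ _ -> //] := FP _ (TG n.+1).
  by have [_ _ ->] := GP _ (Ss n.+1); rewrite ?IH.
split; first by apply: (@sequence_path S s).
apply: (@sequence_path T (fun n => if n is m.+1 then G (s m) else 0)) => //.
  move=> [|n]; split=> //.
    by apply/eqP; rewrite -len_eq0 -[parent _]/(up 1 _) len_up lG.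
  by have [_ _ ->] := GP _ (Ss n.+1); rewrite ?ps.
by case.
Qed.

Section Dichotomy.
Variables S T : nat -> bool.
Hypothesis cS : closed_tree S.
Hypothesis cT : closed_tree T.

Definition maps_above (x y : nat) : Prop := exists F : nat -> nat,
  forall z, extends x z -> T z -> [/\ S (F z), extends y (F z), len (F z) = len z &
    len x < len z -> parent (F z) = F (parent z)].

(** Otherwise every child of [x] in [T] could be mapped above some child of [y], and these maps
    would glue together. *)
Lemma maps_above_children x y : S y -> len x = len y -> ~ maps_above x y ->
  exists i, T (snoc x i) /\ forall k, S (snoc y k) -> ~ maps_above (snoc x i) (snoc y k).
Proof.
move=> Sy El nm; apply: contrapT => H; apply: nm.
have /choice[F FP] i : exists F : nat -> nat, T (snoc x i) -> exists k, S (snoc y k) /\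
    forall z, extends (snoc x i) z -> T z ->
      [/\ S (F z), extends (snoc y k) (F z), len (F z) = len z &
        len (snoc x i) < len z -> parent (F z) = F (parent z)].
  case: (boolP (T (snoc x i))) => Ti; last by exists id.
  apply: contrapT => nF; apply: H; exists i; split=> // k Sk [F FP].
  by apply: nF; exists F => _; exists k.
exists (fun z => if z == x then y else F (get z (len x)) z) => z xz Tz.
case: eqP => [->|ne]; first by rewrite ltnn; split=> //; exact: extends_refl.
have lt : len x < len z.
  have /extendsP[le _] := xz; rewrite ltn_neqAle le andbT.
  by apply/eqP => E; apply: ne; rewrite (extends_len_eq xz E).
have ez := extends_get xz lt; set i := get z (len x) in ez *.
have Ti := closed_extends cT ez Tz.
have [k [Sk kP]] := FP i Ti; have [F1 F2 F3 F4] := kP z ez Tz; split=> //.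
  exact: extends_trans (extends_snoc y k) F2.
move=> _; have z0 : 0 < z by rewrite lt0n -len_eq0; lia.
have Ez := len_parent z0.
case: (ltnP (len (snoc x i)) (len z)) => lt'.
  rewrite F4 //; case: eqP => [E|_]; first by move: lt'; rewrite Ez E len_snoc ltnn.
  by have /extendsP[_ ->] := extends_parent ez lt'; rewrite ?len_snoc // get_snoc ltnn.
have E : snoc x i = z.
  by apply: extends_len_eq ez _; move: lt'; rewrite len_snoc; lia.
rewrite -E parent_snoc eqxx; have -> : F i (snoc x i) = snoc y k.
  by apply/esym/extends_len_eq; rewrite E // F3 -E !len_snoc El.
exact: parent_snoc.
Qed.

Lemma tree_map_dichotomy :
  (exists F, tree_map 0 T S F) \/ (exists F, tree_map 1 S T F).
Proof.
have up0' (Q : nat -> bool) x : closed_tree Q -> Q x -> Q 0.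
  by move=> cQ Qx; rewrite -(up_len x); apply: closed_up.
case: (boolP (S 0)) => S0; last first.
  by right; exists id => x /(up0' _ _ cS); rewrite (negPf S0).
case: (EM (maps_above 0 0)) => [[F FP]|nm].
  left; exists F => x Tx; have [|F1 _ F3 F4] := FP x _ Tx.
    by apply/extendsP; rewrite len0.
  by rewrite addn0; split=> // x0; apply: F4; rewrite lt0n len_eq0 -lt0n.
right.
have /choice[c cP] (xy : nat * nat) : exists i, S xy.2 -> len xy.1 = len xy.2 ->
    ~ maps_above xy.1 xy.2 -> T (snoc xy.1 i) /\
    forall k, S (snoc xy.2 k) -> ~ maps_above (snoc xy.1 i) (snoc xy.2 k).
  case: (EM (S xy.2 /\ len xy.1 = len xy.2 /\ ~ maps_above xy.1 xy.2)) => [[a [b d]]|H].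
    by have [i Hi] := maps_above_children a b d; exists i.
  by exists 0 => a b d; case: H.
(* Along [y], the string [s y] always moves to a child that has no map to any child of the matching
   initial segment of [y]. One further move gives the map that raises levels by one. *)
pose s y := nrec 0 (fun i r => snoc r (c (r, up (len y - i) y))) (len y).
have sE y k : s (snoc y k) = snoc (s y) (c (s y, y)).
  rewrite /s len_snoc [LHS]/= subSn // subnn upS parent_snoc /=.
  set r := nrec _ _ _; set r' := nrec _ _ _; suff -> : r = r' by [].
  by apply: eq_nrec => i lt z; rewrite subSn; [rewrite upS parent_snoc|lia].
have inv y : S y -> len (s y) = len y /\ ~ maps_above (s y) y.
  elim/string_ind: y => [//|y k IH] Sk.
  have Sy : S y by move: (cS Sk); rewrite parent_snoc.
  have [l n] := IH Sy; have [_ H] := cP (s y, y) Sy l n.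
  by rewrite sE !len_snoc l; split=> //; apply: H.
exists (fun y => snoc (s y) (c (s y, y))) => y Sy; have [l n] := inv y Sy.
have [Ty _] := cP (s y, y) Sy l n; rewrite len_snoc l addn1; split=> // y0.
by rewrite parent_snoc -(sE _ (top y)) snocK.
Qed.

End Dichotomy.

(** * A class of functions with no member computable in a generic function *)

(* [value_node n 0] and [value_node n 1] are the trees of the lower bounds    *)
(* that prevent a program from taking the values 0 and 1 at [n].              *)
Definition value_node (n j x : nat) : bool :=
  node (cond_tree (exclude (nfst n) (sentence (nsnd n) n j.+1))) x.

Lemma haspath_node T : haspath (node T) <-> haspath T.
Proof.
split=> -[f fP]; exists f; last exact: node_pre.
by move=> l; apply: (node_up (leq0n _) (fP l)).
Qed.

Lemma value_excludedP n j : value_excluded n j <-> haspath (value_node n j).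
Proof. by rewrite /value_excluded -condP haspath_node. Qed.

Lemma value_node_closed n j : closed_tree (value_node n j).
Proof. by move=> x; apply: node_parent. Qed.

Lemma value_node0 n j : value_node n j 0.
Proof.
apply/ballP => i _; rewrite up0; apply/andP; split=> //.
apply/ballP => k _; apply/ballP => q; rewrite len0 ltnS leqn0 => /eqP ->.
by rewrite implybE orbC.
Qed.

Lemma di_value_node A n j x : computable_in A n -> computable_in A j ->
  computable_in A x -> decidable_in A (fun y => value_node (n y) (j y) (x y)).
Proof.
move=> cn cj cx; rewrite /value_node /node.
apply: (@di_ball A _ (fun y i => _)); first by ci.
apply: di_family; first exact: computable_cond_tree.
  have c1 f : computable_in A f -> computable_in A (fun y => f (nfst y)).
    by move=> cf; apply: ci_comp cf _; ci.
  by rewrite /exclude /sentence; have := c1 _ cn; have := c1 _ cj; auto 20 with ci.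
by apply: ci_up; [ci|apply: ci_comp cx _; ci].
Qed.
#[export] Hint Resolve di_value_node : ci.

(** The local condition for [y] and [y'] to be the images of [x] and its parent. The number [j] is
    both the value and the shift of levels: 0 for the weak comparison of ranks, 1 for the strict
    one. *)
Definition map_ok (n j x y y' : nat) : bool :=
  value_node n (1 - j) x ==>
    [&& value_node n j y, len y == len x + j & (0 < x) ==> (parent y == y')].

Definition survives (n j : nat) : Prop :=
  exists F : nat -> nat, forall x, map_ok n j x (F x) (F (parent x)).

Lemma survivesP n j : survives n j <->
  exists F, tree_map j (value_node n (1 - j)) (value_node n j) F.
Proof.
split=> -[F FP]; exists F => x; have := FP x; rewrite /map_ok.
  move=> /implyP H /H /and3P[-> /eqP -> H']; split=> // x0.
  by move: H'; rewrite x0 => /eqP.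
move=> H; apply/implyP => /H[-> -> H']; rewrite eqxx /=.
by apply/implyP => /H' ->.
Qed.

Lemma survives_excluded n j : value_excluded n j -> survives n j.
Proof. by move=> /value_excludedP/tree_map_path H; apply/survivesP. Qed.

Lemma survives_or n : survives n 0 \/ survives n 1.
Proof.
by rewrite !survivesP; apply: tree_map_dichotomy; apply: value_node_closed.
Qed.

Lemma survives_both n : survives n 0 -> survives n 1 ->
  value_excluded n 0 /\ value_excluded n 1.
Proof.
move=> /survivesP[F FP] /survivesP[G GP]; rewrite !value_excludedP.
by apply: tree_maps_paths FP GP; apply: value_node0.
Qed.

Definition map_tree (n z : nat) : bool :=
  ball (len z) (fun x => map_ok n 0 x (get z x) (get z (parent x))).

Lemma parent_le x : parent x <= x.
Proof. by apply: leq_trans (parent_leq x) (leq_pred x). Qed.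

Lemma map_treeP n : haspath (map_tree n) <-> survives n 0.
Proof.
split=> -[F FP]; exists F; [move=> x|move=> l].
  have /ballP/(_ x) := FP x.+1; rewrite len_pre ltnSn => /(_ isT).
  by rewrite !get_pre // ltnS parent_le.
apply/ballP => x; rewrite len_pre => lt.
by rewrite !get_pre //; apply: leq_ltn_trans lt; apply: parent_le.
Qed.

Lemma di_map_ok A n j x y y' : computable_in A n -> computable_in A j ->
  computable_in A x -> computable_in A y -> computable_in A y' ->
  decidable_in A (fun z => map_ok (n z) (j z) (x z) (y z) (y' z)).
Proof. by move=> *; rewrite /map_ok; auto 20 with ci. Qed.
#[export] Hint Resolve di_map_ok : ci.

Lemma computable_map_tree : computable_family map_tree.
Proof.
move=> A; apply: (@di_ball A _ (fun y x => _)); first by ci.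
by auto 20 with ci.
Qed.

(* The paths of [choice_tree] code a function [n |-> j] with [survives n j]   *)
(* for all [n], together with the witnesses.                                  *)
Definition choice_tree (z : nat) : bool :=
  ball (len z) (fun n => ball (len z) (fun x =>
    [&& npair n 0 < len z, npair n x.+1 < len z & npair n (parent x).+1 < len z] ==>
    (get z (npair n 0) <= 1) && map_ok n (get z (npair n 0)) x
      (get z (npair n x.+1)) (get z (npair n (parent x).+1)))).

Lemma di_choice_tree A f : computable_in A f -> decidable_in A (fun x => choice_tree (f x)).
Proof.
apply: (@ci_comp A (fun z => nat_of_bool (choice_tree z))).
apply: (@di_ball A _ (fun y n => _)); first by ci.
apply: (@di_ball A _ (fun y x => _)); first by ci.
by auto 20 with ci.
Qed.

Lemma choice_treeP f : (forall l, choice_tree (pre f l)) -> forall n,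
  f (npair n 0) <= 1 /\ survives n (f (npair n 0)).
Proof.
move=> H n.
suff Hx x : (f (npair n 0) <= 1) && map_ok n (f (npair n 0)) x
      (f (npair n x.+1)) (f (npair n (parent x).+1)).
  split; first by have /andP[] := Hx 0.
  by exists (fun x => f (npair n x.+1)) => x; have /andP[] := Hx x.
pose l := (n + x + npair n 0 + npair n x.+1 + npair n (parent x).+1).+1.
have l1 : npair n 0 < l by rewrite /l; lia.
have l2 : npair n x.+1 < l by rewrite /l; lia.
have l3 : npair n (parent x).+1 < l by rewrite /l; lia.
have ln : n < l by rewrite /l; lia.
have lx : x < l by rewrite /l; lia.
have /ballP/(_ n) := H l; rewrite len_pre => /(_ ln)/ballP/(_ x lx)/implyP.
by rewrite l1 l2 l3 !get_pre //; apply.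
Qed.

Lemma choice_tree_path : haspath choice_tree.
Proof.
have /choice[j jP] n : exists j, j <= 1 /\ survives n j.
  by have [H|H] := survives_or n; [exists 0|exists 1].
have /choice[F FP] n : exists F : nat -> nat, forall x, map_ok n (j n) x (F x) (F (parent x)).
  by have [_ [F FP]] := jP n; exists F.
exists (fun m => if nsnd m is x.+1 then F (nfst m) x else j (nfst m)) => l.
apply/ballP => n _; apply/ballP => x _; apply/implyP; rewrite len_pre => /and3P[l1 l2 l3].
by rewrite !get_pre // !(nfstK, nsndK) FP andbT; have [] := jP n.
Qed.

Lemma generic_function h : computable_in kleeneO h -> exists g,
  [/\ forall i, h i <= g i, turing_le (jump (graph g)) kleeneO &
      forall f, (forall l, choice_tree (pre f l)) -> ~ computable_in (graph g) f].
Proof.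
move=> ch; have [force [cforce forceP]] := force_exists ch.
pose M n := `[< haspath (map_tree n) >].
have cM : decidable_in kleeneO M by apply: di_haspath computable_map_tree _; ci.
exists (generic force M); split; first exact: (generic_bound forceP).
  exact: (jump_generic cforce forceP cM).
move=> f /choice_treeP fP cf.
have [c cP] : exists c, computes c (graph (generic force M)) (fun n => f (npair n 0)).
  by apply/computable_inP; apply: ci_comp cf _; ci.
have [n [_ d0 d1 d2]] := diagonalize forceP M c.
have [f01 fs] := fP n.
have cn j : phi c (graph (generic force M)) n j -> f (npair n 0) = j.
  by move=> H; apply: evals_fun (cP n) H.
case: (EM (survives n 0)) => s0; last first.
  have Mn : ~~ M n by apply/asboolP => /map_treeP.
  have E : f (npair n 0) = 0 by apply: cn; apply: d0 Mn _ => /survives_excluded.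
  by apply: s0; rewrite -E.
have Mn : M n by apply/asboolP/map_treeP.
case: (EM (survives n 1)) => s1; last first.
  have E : f (npair n 0) = 1 by apply: cn; apply: d1 Mn _ => /survives_excluded.
  by apply: s1; rewrite -E.
have [v0 v1] := survives_both s0 s1; have [n0 n1] := d2 Mn v0 v1.
by have := cP n; case: (f (npair n 0)) f01 => [|[|]].
Qed.

(** * Structures whose isomorphisms compute paths *)

(* The number [a] codes the finite set of the [z] with [bit a z].             *)
Definition bit (a z : nat) : bool := odd (a %/ 2 ^ z).
Definition toggle (a z : nat) : nat := if bit a z then a - 2 ^ z else a + 2 ^ z.

Lemma bitS a z : bit a z.+1 = bit a./2 z.
Proof. by rewrite /bit expnS divnMA divn2. Qed.

Lemma bit0E a : bit a 0 = odd a. Proof. by rewrite /bit divn1. Qed.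

Lemma bit_leq a z : bit a z -> 2 ^ z <= a.
Proof. by rewrite /bit; case: leqP => // lt; rewrite divn_small. Qed.

Lemma bit_lt a z : bit a z -> z < a.
Proof. by move/bit_leq; apply: leq_trans; apply: ltn_expl. Qed.

Lemma bit_nil z : bit 0 z = false. Proof. by rewrite /bit div0n. Qed.

Lemma toggleS a z : toggle a z.+1 = odd a + (toggle a./2 z).*2.
Proof.
have := odd_double_half a; rewrite /toggle bitS expnS mul2n.
by case: ifP => [/bit_leq|_]; lia.
Qed.

Lemma bit_toggle a z y : bit (toggle a z) y = bit a y (+) (y == z).
Proof.
elim: z a y => [|z IH] a y.
  rewrite /toggle bit0E expn0.
  have E : (if odd a then a - 1 else a + 1) = (~~ odd a) + (a./2).*2.
    by have := odd_double_half a; case: (odd a) => /=; lia.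
  rewrite E; case: y => [|y].
    by rewrite !bit0E oddD odd_double addbF oddb eqxx addbT.
  by rewrite !bitS half_bit_double addbF.
rewrite toggleS; case: y => [|y].
  by rewrite !bit0E oddD odd_double addbF oddb addbF.
by rewrite !bitS half_bit_double IH.
Qed.

Lemma bit_inj a b : bit a =1 bit b -> a = b.
Proof.
have [n] := ubnP (a + b); elim: n a b => // n IH a b lt E.
have E0 := E 0; rewrite !bit0E in E0.
case: (posnP (a + b)) => [|pos]; first by lia.
have Eh : a./2 = b./2.
  by apply: IH => [|z]; [lia|have := E z.+1; rewrite !bitS].
by rewrite -(odd_double_half a) -(odd_double_half b) E0 Eh.
Qed.

Lemma toggleK z : involutive (toggle^~ z).
Proof. by move=> a; apply: bit_inj => y; rewrite !bit_toggle addbK. Qed.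

Lemma toggleAC a y z : toggle (toggle a y) z = toggle (toggle a z) y.
Proof. by apply: bit_inj => w; rewrite !bit_toggle addbAC. Qed.

(* The image of a finite set under [parent], counted modulo 2.                *)
Definition proj (a : nat) : nat :=
  nrec 0 (fun z r => if bit a z then toggle r (parent z) else r) a.

Lemma bit_proj a B y : a <= B ->
  bit (proj a) y = \big[addb/false]_(z < B) (bit a z && (parent z == y)).
Proof.
have H C : bit (nrec 0 (fun z r => if bit a z then toggle r (parent z) else r) C) y =
    \big[addb/false]_(z < C) (bit a z && (parent z == y)).
  elim: C => [|C IH]; first by rewrite big_ord0 bit_nil.
  rewrite big_ord_recr /= -IH; case: (bit a C) => /=; last by rewrite addbF.
  by rewrite bit_toggle eq_sym.
move=> /subnK <-; rewrite /proj; elim: (B - a) => [|d IH]; first exact: H.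
rewrite addSn big_ord_recr /= -IH; case b: (bit a (d + a)); last by rewrite addbF.
by have := bit_lt b; lia.
Qed.

Lemma proj0 : proj 0 = 0. Proof. by []. Qed.

(** Counting modulo 2 makes [proj] linear over the field with two elements, so it commutes with
    translation along a path. *)
Lemma proj_toggle a z : proj (toggle a z) = toggle (proj a) (parent z).
Proof.
apply: bit_inj => y; rewrite bit_toggle.
pose B := (toggle a z + a + z).+1.
rewrite (@bit_proj _ B); last by rewrite /B; lia.
rewrite (@bit_proj _ B); last by rewrite /B; lia.
have lt : z < B by rewrite /B; lia.
under eq_bigr => i _ do rewrite bit_toggle andb_addl.
rewrite big_split /=; congr (_ (+) _); rewrite (bigD1 (Ordinal lt)) //= eqxx big1.
  by rewrite addbF eq_sym.
by move=> i /eqP ne; case: eqP => // E; case: ne; apply/val_inj.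
Qed.

Lemma bit_proj_exists a y : bit (proj a) y -> exists z, bit a z && (parent z == y).
Proof.
rewrite (bit_proj _ (leqnn a)) => H; apply: contrapT => nex; move: H.
by rewrite big1 // => i _; apply/negP => H; apply: nex; exists i.
Qed.

Section ComputableBits.
Variable A : set nat.
Local Notation ci := (computable_in A).
Local Notation di := (decidable_in A).

Lemma ci_exp2 f : ci f -> ci (fun x => 2 ^ f x).
Proof.
move=> cf; apply: ci_ext (@ci_nrec A (fun _ => 1) (fun _ _ r => 2 * r) f _ _ cf) _; try ci.
by move=> x; elim: (f x) => [//|n IH] /=; rewrite IH -expnS.
Qed.

Lemma di_bit f g : ci f -> ci g -> di (fun x => bit (f x) (g x)).
Proof.
move=> cf cg; apply: (@ci_comp2 A (fun a z => nat_of_bool (bit a z))) => //.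
pose half_iter y := iter (nsnd y) (fun r => r %/ 2) (nfst y).
have c : ci (fun y => half_iter y %% 2).
  apply: ci_mod => //; apply: (@ci_iter A (fun _ r => r %/ 2)); try ci.
  by apply: ci_div; ci.
apply: ci_ext c _ => y; rewrite modn2 /half_iter /bit; congr (nat_of_bool (odd _)).
move: (nfst y) (nsnd y) => a; elim=> [|n IH]; first by rewrite divn1.
by rewrite /= IH expnSr divnMA.
Qed.

Lemma ci_toggle f g : ci f -> ci g -> ci (fun x => toggle (f x) (g x)).
Proof.
move=> cf cg; have := ci_exp2 cg; have := di_bit cf cg; rewrite /toggle; ci.
Qed.

Lemma ci_proj f : ci f -> ci (fun x => proj (f x)).
Proof.
apply: (@ci_comp A proj).
apply: (@ci_nrec A (fun _ => 0)
  (fun a z r => if bit a z then toggle r (parent z) else r)); try ci.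
apply: di_if; last by ci.
  by apply: di_bit; ci.
by apply: ci_toggle; ci.
Qed.
End ComputableBits.
#[export] Hint Resolve di_bit ci_toggle ci_proj : ci.

Definition path_language : language :=
  Language [set 0]%classic (fun _ => 1) setT (fun _ => 1).

Section PathStructures.
Variable T : nat -> bool.

(* The elements are pairs [npair n a] where [a] is a finite set of nodes of   *)
(* level [n].                                                                 *)
Definition path_dom (x : nat) : bool :=
  ball (nsnd x) (fun z => bit (nsnd x) z ==> node T z && (len z == nfst x)).

Definition path_proj (x : nat) : nat :=
  if nfst x == 0 then x else npair (nfst x).-1 (proj (nsnd x)).

Definition path_toggle (z x : nat) : nat :=
  if node T z && (len z == nfst x) then npair (nfst x) (toggle (nsnd x) z) else x.

Definition path_fun (i x : nat) : nat :=
  if i == 0 then path_proj x else path_toggle i.-1 x.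

Lemma path_domP x : path_dom x <->
  forall z, bit (nsnd x) z -> node T z /\ len z = nfst x.
Proof.
split=> [/ballP H z bz|H].
  by have := H z (bit_lt bz); rewrite bz => /andP[-> /eqP].
by apply/ballP => z _; apply/implyP => /H[-> ->]; rewrite eqxx.
Qed.

Lemma path_dom_toggle n a z : node T z -> len z = n -> path_dom (npair n a) ->
  path_dom (npair n (toggle a z)).
Proof.
move=> Tz Ez /path_domP H; apply/path_domP => y; move: (H y).
rewrite !(nfstK, nsndK) bit_toggle; case: (eqVneq y z) => [->|_] //.
by rewrite addbF.
Qed.

Lemma path_dom_fun i x : path_dom x -> path_dom (path_fun i x).
Proof.
move=> Dx; rewrite /path_fun; case: ifP => _.
  rewrite /path_proj; case: eqP => // /eqP n0; apply/path_domP => y.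
  rewrite !(nfstK, nsndK) => /bit_proj_exists[z /andP[bz /eqP <-]].
  have [Tz lz] := iffLR (path_domP x) Dx z bz; split; first exact: node_parent.
  by rewrite -[parent z]/(up 1 z) len_up lz subn1.
rewrite /path_toggle; case: ifP => // /andP[Tz /eqP Ez].
by apply: path_dom_toggle; rewrite ?npairK.
Qed.

Lemma path_fun_dom i xs : fun_sym path_language i ->
  tuple_in [set` path_dom]%classic (fun_ar path_language i) xs ->
  [set` path_dom]%classic (path_fun i (head 0 xs)).
Proof.
by move=> _ []; case: xs => [|x [|]] //= _ /(_ x (mem_head _ _)); apply: path_dom_fun.
Qed.

(* The relation marks the empty set of level 0 if [m = 0], and the set that   *)
(* consists of the root if [m = 1].                                           *)
Definition path_structure (m : nat) : structure path_language :=
  @Structure path_language [set` path_dom]%classic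
    (fun _ xs => head 0 xs = npair 0 m) (fun i xs => path_fun i (head 0 xs)) path_fun_dom.

Lemma path_language_computable : computable_language path_language.
Proof.
split=> /=.
- apply/turing_leP; apply: ci_ext (di_eq (ci_id _) (ci_const _ 0)) _ => x.
  by congr nat_of_bool; apply/eqP/idP; rewrite in_setE.
- by apply/computable_inP; ci.
- apply/turing_leP; apply: ci_ext (ci_const _ 1) _ => x.
  by rewrite in_setT.
- by apply/computable_inP; ci.
Qed.

Hypothesis cT : forall A f, computable_in A f -> decidable_in A (fun x => T (f x)).

Lemma di_node A f : computable_in A f -> decidable_in A (fun x => node T (f x)).
Proof.
apply: (@ci_comp A (fun z => nat_of_bool (node T z))).
by apply: (@di_ball A _ (fun z i => _)); [ci|apply: cT; ci].
Qed.

Lemma path_structure_computable m : computable_structure (path_structure m).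
Proof.
split=> /=.
- apply/turing_leP; have c : decidable_in set0 path_dom.
    apply: (@di_ball _ _ (fun z i => _)); first by ci.
    apply: di_imp; first by ci.
    by apply: di_and; [apply: di_node|]; ci.
  apply: ci_ext c _ => x; congr nat_of_bool.
  by apply/idP/idP; rewrite in_setE.
- have [c cP] : decidable_in set0 (fun y => top (nsnd y) == npair 0 m) by ci.
  exists (encode c) => i xs _ []; case: xs => [|x [|]] //= _ _.
  rewrite /phi encodeK; have := cP (npair i (npair x 0).+1).
  rewrite nsndK /top /= nfstK.
  by congr (evals _ _ _ (nat_of_bool _)); apply/eqP/asboolP.
have [c cP] : computable_in set0 (fun y => path_fun (nfst y) (top (nsnd y))).
  rewrite /path_fun /path_proj /path_toggle.
  have cn f := @di_node set0 f.
  by auto 20 with ci.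
exists (encode c) => i xs _ []; case: xs => [|x [|]] //= _ _.
rewrite /phi encodeK; have := cP (npair i (npair x 0).+1).
by rewrite nfstK nsndK /top /= nfstK.
Qed.

Lemma path_fun_toggle f i x : (forall l, T (pre f l)) ->
  let iso y := npair (nfst y) (toggle (nsnd y) (pre f (nfst y))) in
  iso (path_fun i x) = path_fun i (iso x).
Proof.
move=> fT iso; rewrite /path_fun; case: ifP => _.
  rewrite /path_proj /iso nfstK; case E: (nfst x) => [|n] /=.
    by rewrite E.
  by rewrite !(nfstK, nsndK) proj_toggle preS parent_snoc.
rewrite /path_toggle /iso !(nfstK, nsndK); case: ifP => // _.
by rewrite !(nfstK, nsndK) toggleAC.
Qed.

Lemma path_structure_isomorphic : haspath T ->
  isomorphic (path_structure 0) (path_structure 1).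
Proof.
move=> [f fT]; pose iso y := npair (nfst y) (toggle (nsnd y) (pre f (nfst y))).
have isoK : involutive iso by move=> y; rewrite /iso !(nfstK, nsndK) toggleK npairK.
have iso_dom y : path_dom y -> path_dom (iso y).
  move=> Dy; apply: path_dom_toggle; rewrite ?npairK ?len_pre //.
  exact: node_pre.
(* The root has code 0, so the set consisting of it has code [2 ^ 0]. *)
have one : iso (npair 0 0) = npair 0 1 by rewrite /iso !(nfstK, nsndK).
exists iso; split=> /=.
- split; first by move=> y; apply: iso_dom.
    by move=> x y _ _; apply: (inv_inj isoK).
  by move=> y Dy; exists (iso y); [apply: iso_dom|apply: isoK].
- move=> i xs _ []; case: xs => [|x [|]] //= _ _; rewrite -one; split=> [->//|].
  exact: inv_inj isoK _ _.
move=> i xs _ []; case: xs => [|x [|]] //= _ _; exact: path_fun_toggle.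
Qed.

(** The images of the empty sets are finite sets [Z n] with [Z n = proj (Z n.+1)], starting from the
    root. By parity each member of [Z n] has a child in [Z n.+1], and a search climbs along
    these. *)
Lemma isomorphism_path A g : haspath T ->
  isomorphism (path_structure 0) (path_structure 1) g ->
  computable_in A (fun n => g (npair n 0)) ->
  exists2 f, computable_in A f & forall l, T (pre f l).
Proof.
move=> [f0 f0T] [[gdom ginj _] grel gfun] cg.
have Dn n : path_dom (npair n 0) by apply/path_domP => z; rewrite nsndK bit_nil.
have gf i x : path_dom x -> g (path_fun i x) = path_fun i (g x).
  move=> Dx; apply: (gfun i [:: x]) => //; split=> // y.
  by rewrite inE => /eqP ->.
pose Z n := nsnd (g (npair n 0)).
(* Toggling a node of level [n] moves all elements of that level and fixes all others, so [g]
   preserves levels. The path [f0] supplies a node at each level. *)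
have level n : nfst (g (npair n 0)) = n.
  apply: contrapT => ne.
  have E : path_fun (pre f0 n).+1 (g (npair n 0)) = g (npair n 0).
    by rewrite /path_fun /= /path_toggle len_pre; case: eqP => [E|]; rewrite ?andbF // -E in ne *.
  rewrite -gf // in E; have := ginj _ _ _ _ E.
  rewrite !inE => /(_ (path_dom_fun _ (Dn n)) (Dn n)).
  rewrite /path_fun /= /path_toggle node_pre // len_pre nfstK eqxx /=.
  move=> /(congr1 (fun x => bit (nsnd x) (pre f0 n))).
  by rewrite !nsndK bit_toggle bit_nil eqxx.
have Z0 : Z 0 = 1.
  have D : tuple_in [set` path_dom]%classic 1 [:: npair 0 0].
    by split=> // y; rewrite inE => /eqP ->; apply: Dn.
  have [H _] := grel 0 [:: npair 0 0] erefl D.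
  by rewrite /Z [g _]H // nsndK.
have ZS n : Z n = proj (Z n.+1).
  have := gf 0 _ (Dn n.+1); rewrite /path_fun /= /path_proj level nfstK nsndK /=.
  by rewrite /Z proj0 => ->; rewrite nsndK.
have Znode n z : bit (Z n) z -> node T z /\ len z = n.
  have /path_domP H : path_dom (g (npair n 0)) by apply: gdom; apply: Dn.
  by move=> /H; rewrite level.
have cZ h : computable_in A h -> computable_in A (fun x => Z (h x)).
  by apply: (@ci_comp A Z); apply: ci_snd.
pose P x z := bit (Z (nfst x)) (nsnd x) ==> bit (Z (nfst x).+1) z && (parent z == nsnd x).
have [||nxt [cnxt nxtP]] := @ci_mu A P.
- by rewrite /P; auto 20 with ci.
- move=> x; rewrite /P; case b: (bit _ _); last by exists 0.
  by rewrite ZS in b; have [z Hz] := bit_proj_exists b; exists z.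
pose s n := nrec 0 (fun n z => nxt (npair n z)) n.
have sP n : bit (Z n) (s n).
  elim: n => [|n IH]; first by rewrite Z0.
  by have [] := nxtP (npair n (s n)); rewrite /P nfstK nsndK IH => /andP[].
have sS n : parent (s n.+1) = s n.
  by have [] := nxtP (npair n (s n)); rewrite /P nfstK nsndK sP => /andP[_ /eqP].
exists (fun n => top (s n.+1)).
  apply: ci_top; apply: (@ci_nrec A (fun _ => 0) (fun _ n z => nxt (npair n z))); try ci.
  by apply: ci_comp cnxt _; ci.
move=> l; suff -> : pre (fun n => top (s n.+1)) l = s l.
  by have [Tn _] := Znode _ _ (sP l); exact: (node_up (leq0n _) Tn).
elim: l => [//|l IH]; rewrite preS IH -sS snocK // lt0n -len_eq0.
by have [_ ->] := Znode _ _ (sP l.+1).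
Qed.

End PathStructures.

(** * Functions that bound paths of descending sequences *)

Lemma ci_graph g : computable_in (graph g) g.
Proof.
have [||f [cf fP]] := @ci_mu (graph g) (fun x m => npair x m \in graph g).
- by ci.
- by move=> x; exists (g x); rewrite in_setE /graph /= nfstK nsndK.
apply: ci_ext cf _ => x; have [+ _] := fP x.
by rewrite in_setE /graph /= nfstK nsndK.
Qed.

Lemma npair_mono x y x' y' : x <= x' -> y <= y' -> npair x y <= npair x' y'.
Proof.
move=> lx ly; rewrite /npair; have H1 := Cantor.to_nat_spec x y.
have H2 := Cantor.to_nat_spec x' y'; nia.
Qed.

(** Since pairing is monotone, this is the largest code of a string of length [l] below [b]; it
    makes the search over such strings finite. *)
Fixpoint string_bound (b : nat -> nat) (l : nat) : nat :=
  if l is l'.+1 then snoc (string_bound b l') (b l') else 0.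

Lemma string_boundP b z : (forall i, i < len z -> get z i <= b i) ->
  z <= string_bound b (len z).
Proof.
elim/string_ind: z => // z x IH H; rewrite len_snoc /= /snoc ltnS; apply: npair_mono.
  by have := H (len z); rewrite len_snoc get_snoc ltnn; apply.
by apply: IH => i lt; have := H i; rewrite len_snoc get_snoc lt ltnS (ltnW lt); apply.
Qed.

Lemma konig (T : nat -> bool) (b : nat -> nat) : closed_tree T ->
  (forall z i, T z -> i < len z -> get z i <= b i) ->
  (forall l, exists2 z, T z & len z = l) -> haspath T.
Proof.
move=> cT Tb Tl.
pose good z := forall l, len z <= l -> exists y, [/\ T y, extends z y & len y = l].
have good0 : good 0.
  move=> l _; have [z Tz lz] := Tl l; exists z; split=> //.
  by apply/extendsP; rewrite len0.
have goodS z : good z -> exists k, good (snoc z k).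
  move=> gz; apply: contrapT => H.
  have /choice[L LP] k : exists l, len (snoc z k) <= l /\
      ~ exists y, [/\ T y, extends (snoc z k) y & len y = l].
    apply: contrapT => nL; apply: H; exists k => l le; apply: contrapT => ny.
    by apply: nL; exists l.
  (* A level past those at which the finitely many children allowed by [b] fail. *)
  pose m := (len z + \max_(k < (b (len z)).+1) L k).+1.
  have [|y [Ty zy ly]] := gz m; first by rewrite /m; lia.
  have lt : len z < len y by rewrite ly /m; lia.
  have ez := extends_get zy lt; set k := get y (len z) in ez.
  have lk : k < (b (len z)).+1 by rewrite ltnS; apply: Tb.
  have Lm : L k <= m by rewrite /m; have /= := leq_bigmax (F := fun k : 'I__ => L k) (Ordinal lk); lia.
  have [le []] := LP k; exists (up (len y - L k) y); split.
  - exact: closed_up.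
  - apply/extendsP; rewrite up_lenB ?len_pre //; last by rewrite ly.
    split=> // i lti; rewrite get_pre; last exact: leq_trans lti le.
    by have /extendsP[_ ->] := ez.
  - by rewrite up_lenB ?len_pre // ly.
have /choice[nxt nxtP] z : exists k, good z -> good (snoc z k).
  by case: (EM (good z)) => [/goodS[k gk]|ng]; [exists k|exists 0].
pose s := fix s l := if l is l'.+1 then snoc (s l') (nxt (s l')) else 0.
apply: (@sequence_path T s) => // n; first by rewrite /= parent_snoc.
have gs : good (s n) by elim: n => //= n /nxtP.
by have [y [Ty sy _]] := gs _ (leqnn _); apply: closed_extends sy Ty.
Qed.

Lemma desc_tree_closed e : closed_tree (desc_tree e).
Proof.
move=> z; case: (posnP z) => [->|z0]; first by rewrite parent0.
move=> /ballP H; apply/ballP => i lt.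
have E := len_parent z0.
have gE j : j < len (parent z) -> get (parent z) j = get z j.
  by move=> lj; rewrite -{2}(snocK z0) get_snoc lj.
have lt' : i < len z by lia.
have /andP[Di /implyP Li] := H i lt'; rewrite gE // Di /=.
by apply/implyP => lt2; rewrite gE //; apply: Li; lia.
Qed.

Section Bounding.
Variables g : nat -> nat.
Hypothesis gP : forall e, haspath (desc_tree e) -> exists2 f,
  (forall l, desc_tree e (pre f l)) & forall n, f n <= g (npair e n).

(* [e] is in O if and only if the part below [g] of its tree is finite.       *)
Lemma kleeneO_sigma1 : exists E : nat -> nat -> bool,
  decidable_in (graph g) (fun y => E (nfst y) (nsnd y)) /\
  forall e, e \in kleeneO <-> exists l, E e l.
Proof.
have [t [ct tP]] := kleeneO_lo_wf.
pose b e i := g (npair (t e) i).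
pose bounded e z := ball (len z) (fun i => get z i <= b e i).
pose E e l := ball (string_bound (b e) l).+1 (fun z =>
  (len z == l) && bounded e z ==> ~~ desc_tree (t e) z).
have cg := ci_graph g.
have cb f h : computable_in (graph g) f -> computable_in (graph g) h ->
    computable_in (graph g) (fun x => b (f x) (h x)).
  move=> cf ch; apply: (ci_comp cg); apply: ci_pair => //.
  exact: ci_comp (ct _) cf.
have ctt f : computable_in (graph g) f -> computable_in (graph g) (fun x => t (f x)).
  exact: ci_comp (ct _).
exists E; split.
  apply: (@di_ball _ _ (fun y z => _)).
    apply: ci_succ.
    have c := @ci_nrec (graph g) (fun _ => 0) (fun y i r => snoc r (b (nfst y) i)) nsnd.
    apply: ci_ext (c _ _ _) _; try ci.
    by move=> y; elim: (nsnd y) => //= l ->.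
  apply: di_imp.
    apply: di_and; first by ci.
    by apply: (@di_ball _ _ (fun y z => _)); ci.
  by apply: di_neg; apply: di_family; [exact: computable_desc_tree| |]; ci.
move=> e; rewrite tP; split=> [wf|[l /ballP El]].
  apply: contrapT => nE; have /lo_wf_desc := wf; apply.
  have [|||f fT] := @konig (fun z => desc_tree (t e) z && bounded e z) (b e).
  - move=> z /andP[/desc_tree_closed -> /ballP H] /=; apply/ballP => i lt.
    have z0 : 0 < z by case: (posnP z) lt => // ->; rewrite parent0.
    have -> : get (parent z) i = get z i by rewrite -{2}(snocK z0) get_snoc lt.
    by apply: H; rewrite (len_parent z0) ltnS (ltnW lt).
  - by move=> z i /andP[_ /ballP H]; apply: H.
  - move=> l; apply: contrapT => nz; apply: nE; exists l; apply/ballP => z _.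
    apply/implyP => /andP[/eqP lz bz]; apply/negP => Dz; apply: nz.
    by exists z; rewrite ?Dz.
  by exists f; apply/desc_treeP => l; have /andP[] := fT l.
apply/lo_wf_desc => -[s /desc_treeP sP].
have [f fT fb] := gP (ex_intro _ s sP).
have bf : forall i, i < len (pre f l) -> get (pre f l) i <= b e i.
  by move=> i; rewrite len_pre => lt; rewrite get_pre //; apply: fb.
have le : pre f l < (string_bound (b e) l).+1.
  by have := string_boundP bf; rewrite len_pre.
have := El _ le; rewrite len_pre eqxx fT implybF => /negP; apply.
exact/ballP.
Qed.

(* The largest element of L_e among those below [B], and below [lim.-1] in    *)
(* L_e if [0 < lim]; the results are shifted by 1, with 0 for none.           *)
Definition largest (e lim B : nat) : nat :=
  nrec 0 (fun x r => if lo_dom e x && ((lim == 0) || lo_lt e x lim.-1) &&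
    ((r == 0) || lo_lt e r.-1 x) then x.+1 else r) B.

Lemma largestP e lim B y : y < B -> lo_dom e y -> (lim == 0) || lo_lt e y lim.-1 ->
  exists x, [/\ largest e lim B = x.+1, lo_dom e x,
    (lim == 0) || lo_lt e x lim.-1 & lo_le e y x].
Proof.
move=> ltB Dy ly; have [tot [anti trans]] := lo_linear e.
have refl x : lo_dom e x -> lo_le e x x.
  by move=> Dx; have := tot x x Dx Dx; rewrite orbb.
pose ok x := lo_dom e x && ((lim == 0) || lo_lt e x lim.-1).
suff H C : (largest e lim C = 0 /\ forall y, y < C -> ~~ ok y) \/
    exists x, [/\ largest e lim C = x.+1, ok x & forall y, y < C -> ok y -> lo_le e y x].
  have oky : ok y by rewrite /ok Dy ly.
  case: (H B) => [[_ /(_ y ltB)]|[x [-> /andP[Dx lx] /(_ y ltB oky) le]]].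
    by rewrite oky.
  by exists x.
elim: C => [|C IH]; first by left.
have -> : largest e lim C.+1 = if ok C &&
    ((largest e lim C == 0) || lo_lt e (largest e lim C).-1 C) then C.+1 else largest e lim C.
  by [].
case: IH => [[E0 no]|[x [Ex okx max]]].
  rewrite E0 /= andbT; case okC: (ok C).
    right; exists C; split=> // z; rewrite ltnS leq_eqVlt => /orP[/eqP ->|/no /negP //].
    by move=> /andP[Dz _]; apply: refl.
  left; split=> // z; rewrite ltnS leq_eqVlt => /orP[/eqP ->|/no //].
  by rewrite okC.
right; rewrite Ex /=; have Dx : lo_dom e x by have /andP[] := okx.
case okC: (ok C) => /=; last first.
  exists x; split=> // z; rewrite ltnS leq_eqVlt => /orP[/eqP ->|]; first by rewrite okC.
  exact: max.
have DC : lo_dom e C by have /andP[] := okC.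
case: ifP => lt.
  exists C; split=> // z; rewrite ltnS leq_eqVlt => /orP[/eqP -> _|lz okz].
    exact: refl.
  have /andP[Dz _] := okz; have /andP[xC _] := lt.
  exact: trans (max _ lz okz) xC.
exists x; split=> // z; rewrite ltnS leq_eqVlt => /orP[/eqP -> _|]; last exact: max.
have /orP[xC|//] := tot x C Dx DC; move: lt; rewrite /lo_lt xC /= => /negbFE/eqP ->.
exact: refl.
Qed.

(** If [f] is a descending sequence below [g], the element chosen at step [n] stays at or above
    [f n] in L_e. So [f n.+1] is a candidate for the next step, and the choice never fails. *)
Lemma bounding_finds : exists f, computable_fun f /\ finds_descending (graph g) f.
Proof.
have cg := ci_graph g.
pose s e n := nrec (largest e 0 (g (npair e 0)).+1)
  (fun n r => largest e r (g (npair e n.+1)).+1) n.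
have cl a b c : computable_in (graph g) a -> computable_in (graph g) b ->
    computable_in (graph g) c -> computable_in (graph g) (fun x => largest (a x) (b x) (c x)).
  move=> ca cb cc; apply: (@ci_comp3 _ largest) => //.
  apply: (@ci_nrec _ (fun _ => 0) (fun y x r => if lo_dom (nfst y) x &&
    ((nfst (nsnd y) == 0) || lo_lt (nfst y) x (nfst (nsnd y)).-1) &&
    ((r == 0) || lo_lt (nfst y) r.-1 x) then x.+1 else r)); try ci.
have cgg f : computable_in (graph g) f -> computable_in (graph g) (fun x => g (f x)).
  exact: ci_comp cg.
have [c cP] : computable_in (graph g) (fun y => (s (nfst y) (nsnd y)).-1).
  apply: ci_pred; apply: (@ci_nrec _ (fun y => largest (nfst y) 0 (g (npair (nfst y) 0)).+1)
    (fun y n r => largest (nfst y) r (g (npair (nfst y) n.+1)).+1)); try ci.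
exists (smn c); split; first by apply/computable_inP; ci.
move=> e /lo_wf_desc nwf.
have [f fT fb] : exists2 f, (forall l, desc_tree e (pre f l)) & forall n, f n <= g (npair e n).
  by apply: gP; apply: contrapT => H; apply: nwf => -[f /desc_treeP fP]; apply: H; exists f.
have /desc_treeP fD := fT; have [_ [anti trans]] := lo_linear e.
exists (fun n => (s e n).-1); split.
  by move=> n; apply/smnP; have := cP (npair e n); rewrite nfstK nsndK.
have Df n : lo_dom e (f n) by have [] := fD n.
have below n x : lo_dom e x -> lo_le e (f n) x -> lo_lt e (f n.+1) x.
  move=> Dx le; have [_ /andP[le' ne]] := fD n.
  have le2 := trans _ _ _ (Df n) (Df n.+1) Dx le' le.
  rewrite /lo_lt le2; apply/eqP => E; move: ne; apply/negP; rewrite negbK; apply/eqP.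
  by apply: anti => //; [exact: Df|exact: Df|rewrite le' E le].
have H n : exists x, [/\ s e n = x.+1, lo_dom e x & lo_le e (f n) x].
  elim: n => [|n [x [Ex Dx le]]].
    have [x [Ex Dx _ le]] := @largestP e 0 (g (npair e 0)).+1 (f 0) (fb 0) (Df 0) isT.
    by exists x.
  have lt := below n x Dx le.
  have [y [Ey Dy _ le2]] :=
    @largestP e x.+1 (g (npair e n.+1)).+1 (f n.+1) (fb n.+1) (Df n.+1) lt.
  by exists y; split=> //; rewrite -Ey -Ex.
move=> n; have [x [Ex Dx le]] := H n; rewrite Ex; split=> //.
have lt := below n x Dx le.
have [y [Ey Dy lyx _]] :=
  @largestP e x.+1 (g (npair e n.+1)).+1 (f n.+1) (fb n.+1) (Df n.+1) lt.
move: lyx => /= lyx; have -> : s e n.+1 = y.+1 by rewrite -Ey -Ex.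
exact: lyx.
Qed.

Lemma kleeneO_le_jump : turing_le kleeneO (jump (graph g)).
Proof.
have [E [cE EP]] := kleeneO_sigma1; have [r [cr rP]] := sigma1_jump cE.
apply/turing_leP; apply: ci_ext (di_oracle (cr (jump (graph g)))) _ => e.
by congr nat_of_bool; apply/idP/idP; rewrite EP rP.
Qed.

(* Below a reticent [B], both O and its complement are enumerable.            *)
Lemma reticent_above B f : turing_le (graph g) B -> computable_fun f ->
  finds_descending B f -> (forall e, lo_wf e -> forall n m, ~ phi (f e) B n m) ->
  turing_le kleeneO B.
Proof.
move=> gB /computable_fun_in cf fP fR.
have [E [/(computable_in_le gB) cE EP]] := kleeneO_sigma1.
have [t [ct tP]] := kleeneO_lo_wf.
pose Q e k := 0 < evalo k (oracle B) (f (t e)) 0.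
have cQ : decidable_in B (fun y => Q (nfst y) (nsnd y)).
  apply: di_leq; first by ci.
  apply: ci_evalo_oracle; try ci.
  by apply: ci_comp (cf B) _; apply: ci_comp (ct B) _; ci.
have QP e k : Q e k -> ~ lo_wf (t e).
  rewrite /Q; case Ek: evalo => [//|m] _ /fR; apply.
  by apply/phiP; exists k; exact: Ek.
(* Every [e] shows up in one of the two enumerations, and reticence prevents it from showing up in
   both. *)
have [||h [ch hP]] := @ci_mu B (fun e k => E e k || Q e k).
- exact: di_or.
- move=> e; case: (EM (lo_wf (t e))) => [/tP/EP[k Ek]|nwf].
    by exists k; rewrite Ek.
  have [s [/(_ 0)/phiP[k Ek] _]] := fP _ nwf.
  by exists k; rewrite /Q Ek orbT.
apply/turing_leP.
have c : decidable_in B (fun e => E e (h e)).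
  by apply: (@ci_comp2 B (fun e k => nat_of_bool (E e k))); try ci.
apply: ci_ext c _ => e; congr nat_of_bool; have [H _] := hP e.
apply/idP/idP => [Eh|/tP wf]; first by apply/EP; exists (h e).
by case/orP: H => // /QP.
Qed.

End Bounding.

(** * The degree of the graph of the generic function *)

Theorem mainTheorem19 :
  exists d : degree,
    is_jump d (degree_of kleeneO) /\
    unif_high_desc d /\
    ~ high_for_iso d /\
    ~ (exists b : degree,
         degree_le d b /\
         ~ degree_le (degree_of kleeneO) b /\
         unif_high_desc_reticent b).
Proof.
have [h [ch hP]] := leftmost_path computable_desc_tree.
have [g [hg gO gQ]] := generic_function ch.
have gP e : haspath (desc_tree e) -> exists2 f,
    (forall l, desc_tree e (pre f l)) & forall n, f n <= g (npair e n).
  by move=> /hP[f fT fh]; exists f => // n; rewrite -fh.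
pose D := graph g.
have DD : turing_equiv D D by apply: turing_equiv_refl.
exists (degree_of D); split; [|split; [|split]].
- move=> D' /= [D'D DD']; split; first exact: turing_le_trans (jump_le D'D) gO.
  exact: turing_le_trans (kleeneO_le_jump gP) (jump_le DD').
- by have [f [cf fP]] := bounding_finds gP; exists D, f.
- move=> hi.
  have [phi_ [isoP [D' [e [/= [D'D _] eP]]]]] :=
    hi _ _ _ path_language_computable
      (path_structure_computable di_choice_tree 0)
      (path_structure_computable di_choice_tree 1)
      (path_structure_isomorphic choice_tree_path).
  have c : computable_in D (fun n => phi_ (npair n 0)).
    apply: (computable_in_le D'D).
    have [c cP] : computable_in D' (fun n => npair n 0) by ci.
    exists (CComp (decode e) c) => n; apply: evals_comp (cP n) (eP _ _).
    by apply/path_domP => z; rewrite nsndK bit_nil.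
  have [f cf fT] := isomorphism_path choice_tree_path isoP c.
  exact: gQ fT cf.
move=> [b [db [nO [B [f [bB cf fP fR]]]]]]; apply: nO => A C /= [AO _] bC.
have OB := reticent_above gP (db D B DD bB) cf fP fR.
apply: turing_le_trans AO (turing_le_trans OB _).
have [B0 EB0] := degree_classP b; move: bB bC; rewrite EB0 /= => -[B1 _] [_ C2].
exact: turing_le_trans B1 C2.
Qed.
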